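(* Let $k\geq 4$ be an even integer and write $$G_k = \sum_{\substack{a,b\geq 0\\ 4a+6b=k}} w_{a,k}\, G_4^{a} G_6^{b}$$ with $w_{a,k}\in\mathbb{Q}$. Then $\min_a \nu_2(w_{a,k}) \geq 0$, i.e. $\nu_2(w_{a,k})\geq 0$ for every $a$.
   Context: For even $k\ge 4$, $E_k(z) = 1-\frac{2k}{B_k}\sum_{n\geq 1}\sigma_{k-1}(n)e^{2\pi i n z}$ is the normalized Eisenstein series of weight $k$ on $\mathrm{SL}_2(\mathbb{Z})$, $\zeta$ is the Riemann zeta function, and $G_k = 2\zeta(k)E_k$. The coefficients $w_{a,k}$ are uniquely determined since the monomials $G_4^aG_6^b$ with $4a+6b=k$ form a basis of the space of modular forms of weight $k$. For a prime $p$, $\nu_p$ is the $p$-adic valuation on $\mathbb{Q}$ with $\nu_p(0)=\infty$. *)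

(* Defs.v *)
From HB Require Import structures.
From mathcomp Require Import all_boot all_order all_algebra.
From mathcomp Require Import all_classical all_reals all_analysis.
Set Implicit Arguments. Unset Strict Implicit. Unset Printing Implicit Defensive.
Import Order.TTheory GRing.Theory Num.Theory.
Local Open Scope ring_scope.

(* Bernoulli numbers B_0, B_1, ... (B_1 = -1/2), via
   sum_{j=0}^{m} C(m+1, j) B_j = 0 for m >= 1, B_0 = 1. *)
Fixpoint bern_seq (n : nat) : seq rat :=
  match n with
  | 0%N => [:: 1]
  | n'.+1 => let s := bern_seq n' in
      rcons s (- (n'.+2%:R)^-1 * \sum_(j < n'.+1) ('C(n'.+2, j))%:R * s`_j)
  end.
Definition bernoulli (n : nat) : rat := (bern_seq n)`_n.

Definition sigma (r n : nat) : nat := \sum_(d <- divisors n) d ^ r.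

Definition zeta {R : realType} (k : nat) : R :=
  limn (fun N => \sum_(1 <= n < N) ((n%:R : R) ^- k)).

(* q-expansions: a modular form f(z) = sum_{n>=0} c_n e^{2 pi i n z} is
   represented by its coefficient sequence (c_n). *)
Definition qexp (R : Type) := nat -> R.

Definition E_qexp {R : realType} (k : nat) : qexp R := fun n =>
  if n == 0%N then 1
  else - ratr ((2 * k)%:R / bernoulli k) * ((sigma k.-1 n)%:R : R).

Definition G_qexp {R : realType} (k : nat) : qexp R :=
  fun n => 2 * zeta k * E_qexp k n.

Definition qmul {R : ringType} (f g : qexp R) : qexp R :=
  fun n => \sum_(i < n.+1) f i * g (n - i)%N.
Definition qone {R : ringType} : qexp R := fun n => if n == 0%N then 1 else 0.
Definition qpow {R : ringType} (f : qexp R) (m : nat) : qexp R :=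
  iter m (qmul f) qone.

(* p-adic valuation on Q, with nu_p(0) = infinity (encoded as None) *)
Definition nu (p : nat) (q : rat) : option int :=
  if q == 0 then None
  else Some ((logn p `|numq q|)%:Z - (logn p `|denq q|)%:Z).

Definition nu_ge0 (p : nat) (q : rat) : Prop :=
  match nu p q with None => True | Some v => (0 <= v)%R end.

(* Main.v *)
(* Write wp for the Weierstrass function of the lattice, and expand it as
   z^-2 + sum_(n >= 2) (2n-1) G_2n z^(2n-2).  Comparing coefficients in
   (wp'/2)^2 = wp^3 - 15 G_4 wp - 35 G_6 gives
     (2n+1)(2n-1) G_2n = an integral polynomial in G_4, G_6 and the
                         (2m-1) G_2m with m < n,
   and (2n+1)(2n-1) is odd, so G_2n is a polynomial in G_4, G_6 over Z_(2).
   (The usual quadratic recurrence, from wp'' = 6 wp^2 - 30 G_4, only gives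
   (n-3)(2n+1)(2n-1) G_2n, which loses 2-adic integrality for n odd.)

   The differential equation for the q-expansions is Ramanujan's: it follows
   from u_m u_n = u_(m+n) (1 + u_m + u_n) for u_m = q^m / (1 - q^m).  Euler's
   2 zeta(2n) = - (- T)^n B_2n / (2n)!, with T = 24 zeta(2), is only needed to
   remove the transcendental factors; the identification T = (2 pi)^2 plays no
   role.  Monomials in G_4, G_6 of a given weight are independent because
   G_4^3 / G_6^2 has a nonzero coefficient of q. *)
Require Import Defs.
From HB Require Import structures.
From mathcomp Require Import all_boot all_order all_algebra.
From mathcomp Require Import all_classical all_reals all_analysis.
From mathcomp Require Import qpoly ring lra zify.
Import Order.TTheory GRing.Theory Num.Theory.
Set Implicit Arguments. Unset Strict Implicit. Unset Printing Implicit Defensive.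
Local Open Scope ring_scope.

(** * Formal power series *)

(** The functions of z and q are purely formal. Power series in z have coefficients in
    Q[q]/(q^(N+1)), and z is scaled so that the lattice is 2 pi i times the usual one. All
    coefficients are then rational: G_k is replaced by G_k / (2 pi i)^k, and the discarded power is
    common to all monomials of one weight. The Lambert sums yield the second-order equation; the
    first-order one is its first integral. The delicate point is the prime 2 itself: with z^2 wp = 1
    + P, the first-order equation must be divided by 4 before the odd factor j + 1 of P_j appears.
    This works because z^3 wp' = 2 (H - 1), where H has coefficients (j/2 - 1) P_j, and P_j vanishes
    for j odd, there being no monomial of odd weight. The recurrence only produces some 2-integral
    expression of G_k. Independence, which already holds modulo q^(k+1), identifies it with the
    given one. *)

Definition fps (K : Type) := nat -> K.

Section FpsRing.
Variable K : comNzRingType.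
Implicit Types f g h : fps K.

HB.instance Definition _ := GRing.Zmodule.copy (fps K) (nat -> K).

Definition fps_one : fps K := fun n => (n == 0%N)%:R.
Definition fps_mul f g : fps K := fun n => \sum_(i < n.+1) f i * g (n - i)%N.

Lemma fps_mulC : commutative fps_mul.
Proof.
move=> f g; apply/funext => n; rewrite /fps_mul (reindex_inj rev_ord_inj) /=.
by apply: eq_bigr => i _; rewrite subSS subKn 1?mulrC // -ltnS.
Qed.

Lemma fps_mulE_poly f g n N : (n < N)%N ->
  fps_mul f g n = ((\poly_(i < N) f i) * (\poly_(i < N) g i))`_n.
Proof.
move=> nN; rewrite coefM; apply: eq_bigr => i _.
have iN : (i < N)%N by apply: leq_ltn_trans nN; rewrite -ltnS.
by rewrite !coef_poly iN (leq_ltn_trans (leq_subr _ _) nN).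
Qed.

Lemma fps_mulA : associative fps_mul.
Proof.
move=> f g h; apply/funext => n.
set P := fun f : fps K => \poly_(i < n.+1) f i.
have E (p q : fps K) (k : {poly K}) : (P (fps_mul p q) * k)`_n = (P p * P q * k)`_n.
  rewrite !coefM; apply: eq_bigr => i _.
  by rewrite coef_poly ltn_ord (@fps_mulE_poly _ _ _ n.+1).
rewrite fps_mulC !(@fps_mulE_poly _ _ n n.+1) //.
by rewrite E (E f g) mulrC mulrA.
Qed.

Lemma fps_mul1 : left_id fps_one fps_mul.
Proof.
move=> f; apply/funext => n; rewrite /fps_mul big_ord_recl /= mul1r subn0.
by rewrite big1 ?addr0 // => i _; rewrite mul0r.
Qed.

Lemma fps_mulDl : left_distributive fps_mul +%R.
Proof.
move=> f g h; apply/funext => n; rewrite /fps_mul.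
by rewrite -[RHS]big_split; apply: eq_bigr => i _; rewrite mulrDl.
Qed.

Lemma fps_one_neq0 : fps_one != 0 :> fps K.
Proof. by apply/eqP => /(congr1 (fun f => f 0%N)) /eqP; rewrite oner_eq0. Qed.

HB.instance Definition _ := GRing.Zmodule_isComNzRing.Build (fps K)
  fps_mulA fps_mulC fps_mul1 fps_mulDl fps_one_neq0.

Lemma fpsD f g n : (f + g) n = f n + g n. Proof. by []. Qed.
Lemma fpsN f n : (- f) n = - f n. Proof. by []. Qed.
Lemma fps0 n : (0 : fps K) n = 0. Proof. by []. Qed.
Lemma fps1 n : (1 : fps K) n = (n == 0%N)%:R. Proof. by []. Qed.
Lemma fpsM f g n : (f * g) n = \sum_(i < n.+1) f i * g (n - i)%N.
Proof. by []. Qed.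
Lemma fpsMn f m n : (f *+ m) n = f n *+ m.
Proof. by elim: m => // m IH; rewrite !mulrS fpsD IH. Qed.
Lemma fps_sum I (r : seq I) (P : pred I) (F : I -> fps K) n :
  (\sum_(i <- r | P i) F i) n = \sum_(i <- r | P i) F i n.
Proof. by elim/big_rec2: _ => // i y1 y2 _ <-. Qed.

Definition fpsC (c : K) : fps K := fun n => if n == 0%N then c else 0.

Lemma fpsCM c f n : (fpsC c * f) n = c * f n.
Proof.
rewrite fpsM big_ord_recl /= subn0 big1 ?addr0 // => i _.
by rewrite /fpsC mul0r.
Qed.

Lemma fpsC_is_zmod_morphism : zmod_morphism fpsC.
Proof.
by move=> a b; apply/funext => -[|n]; rewrite fpsD fpsN // /fpsC subr0.
Qed.
Lemma fpsC_is_monoid_morphism : monoid_morphism fpsC.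
Proof.
split=> [|a b]; first by apply/funext => -[].
by apply/funext => -[|n]; rewrite fpsCM // /fpsC /= mulr0.
Qed.
HB.instance Definition _ := GRing.isZmodMorphism.Build K (fps K) fpsC
  fpsC_is_zmod_morphism.
HB.instance Definition _ := GRing.isMonoidMorphism.Build K (fps K) fpsC
  fpsC_is_monoid_morphism.

Definition fpsX : fps K := fun n => (n == 1%N)%:R.

Lemma fpsXM f n : (fpsX * f) n = if n is m.+1 then f m else 0.
Proof.
rewrite fpsM; case: n => [|n]; first by rewrite big_ord1 mul0r.
rewrite 2!big_ord_recl /= /fpsX /= mul0r mul1r add0r subn1 /=.
by rewrite big1 ?addr0 // => i _; rewrite mul0r.
Qed.

Lemma fpsXnM f k n : (fpsX ^+ k * f) n = if (k <= n)%N then f (n - k)%N else 0.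
Proof.
elim: k n => [|k IH] n; first by rewrite mul1r subn0.
by rewrite exprS -mulrA fpsXM; case: n => [//|n]; rewrite IH.
Qed.

Lemma fpsXn k n : (fpsX ^+ k) n = (n == k)%:R.
Proof.
rewrite -[fpsX ^+ k]mulr1 fpsXnM fps1.
by case: ltngtP => // [kn|->]; rewrite ?subnn // subn_eq0 leqNgt kn.
Qed.

Lemma fpsXn_lreg k : GRing.lreg (fpsX ^+ k).
Proof.
move=> f g /(congr1 (fun h => fun n => h (k + n)%N)) /= E; apply/funext => n.
by move/(congr1 (fun h => h n)): E; rewrite !fpsXnM leq_addr addKn.
Qed.

(* z d/dz *)
Definition fps_theta f : fps K := fun n => f n *+ n.

Lemma fps_theta_is_zmod_morphism : zmod_morphism fps_theta.
Proof. by move=> f g; apply/funext => n; rewrite /fps_theta mulrnBl. Qed.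
HB.instance Definition _ := GRing.isZmodMorphism.Build (fps K) (fps K) fps_theta
  fps_theta_is_zmod_morphism.

Lemma fps_thetaM f g : fps_theta (f * g) = fps_theta f * g + f * fps_theta g.
Proof.
apply/funext => n; rewrite fpsD !fpsM /fps_theta fpsM -sumrMnl -big_split.
apply: eq_bigr => i _ /=; rewrite mulrnAl mulrnAr -mulrnDr.
by rewrite subnKC // -ltnS.
Qed.

Lemma fps_thetaC c : fps_theta (fpsC c) = 0.
Proof. by apply/funext => -[|n]; rewrite /fps_theta /fpsC /= ?mul0rn. Qed.

Lemma fps_thetaXn k : fps_theta (fpsX ^+ k) = fpsX ^+ k *+ k.
Proof.
apply/funext => n; rewrite fpsMn /fps_theta fpsXn.
by case: eqP => [->//|_]; rewrite !mul0rn.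
Qed.

End FpsRing.

(** * Ramanujan's identity *)

Lemma sum_nat_shift (V : zmodType) (F : nat -> V) (N m : nat) :
  (forall n, (N < n + m)%N -> F n = 0) ->
  \sum_(1 <= n < N.+1) F n = \sum_(1 <= s < N.+1 | (m < s)%N) F (s - m)%N.
Proof.
move=> F0; have -> : \sum_(1 <= s < N.+1 | (m < s)%N) F (s - m)%N =
    \sum_(m.+1 <= s < N.+1) F (s - m)%N.
  by rewrite [RHS](big_nat_widenl _ 1).
rewrite -[m.+1]add1n big_addn; under [RHS]eq_bigr do rewrite addnK.
have [mN|Nm] := leqP m N; last first.
  rewrite [RHS]big_geq; last lia.
  by rewrite big_nat big1 // => n ?; apply: F0; lia.
rewrite (@big_cat_nat _ _ _ (N.+1 - m)%N) /=; [|lia|lia].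
rewrite [X in _ + X]big_nat [X in _ + X]big1 ?addr0 // => n ?.
by apply: F0; lia.
Qed.

(** Off-diagonal pairs are indexed by their smaller entry [m] and their difference [s]; the
    vanishing hypothesis absorbs the pairs with m + s > N. *)
Lemma sum_nat_sym (V : zmodType) (G : nat -> nat -> V) (N : nat) :
  (forall m n, G m n = G n m) -> (forall m n, (N < n)%N -> G m n = 0) ->
  \sum_(1 <= m < N.+1) \sum_(1 <= n < N.+1) G m n =
  \sum_(1 <= m < N.+1) G m m +
  (\sum_(1 <= s < N.+1) \sum_(1 <= m < N.+1) G m (m + s)%N) *+ 2.
Proof.
move=> GC G0.
have H : \sum_(1 <= s < N.+1) \sum_(1 <= m < N.+1) G m (m + s)%N =
    \sum_(1 <= m < N.+1) \sum_(1 <= n < N.+1 | (m < n)%N) G m n.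
  rewrite exchange_big /=; apply: eq_bigr => m _.
  rewrite (@sum_nat_shift _ (fun s => G m (m + s)%N) N m); last first.
    by move=> n ?; apply: G0; lia.
  by apply: eq_bigr => s ms; rewrite subnKC // ltnW.
have H' : \sum_(1 <= m < N.+1) \sum_(1 <= n < N.+1 | (m < n)%N) G m n =
    \sum_(1 <= m < N.+1) \sum_(1 <= n < N.+1 | (n < m)%N) G m n.
  rewrite (exchange_big_dep xpredT) //=; apply: eq_bigr => m _.
  by apply: eq_bigr => n _.
rewrite H mulr2n {2}H' addrA -!big_split /=.
apply: eq_big_nat => m m1.
rewrite (bigID (fun n => (n < m)%N)) /= [RHS]addrC; congr (_ + _).
rewrite (bigID (fun n => n == m)) /=; congr (_ + _).
  rewrite (eq_bigl (fun n => n == m)); last by move=> n; lia.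
  by rewrite big_nat1_eq m1.
by apply: eq_bigl => n; lia.
Qed.

(* To be read with u m = q^m / (1 - q^m), c m = 2 cosh (m z) and
   S = tau / (4 sinh^2 (z/2)); [u_big] makes all sums finite. *)
Section Ramanujan.
Variables (L : comNzRingType) (u c : nat -> L) (S tau : L) (N : nat).
Hypothesis u_mul : forall m n, (0 < m)%N -> (0 < n)%N ->
  u m * u n = u (m + n)%N * (1 + u m + u n).
Hypothesis u_big : forall m, (N < m)%N -> u m = 0.
Hypothesis c0 : c 0%N = 2.
Hypothesis c_mul : forall m n, c (m + n)%N * c n = c (m + n + n)%N + c m.
Hypothesis S_tau : S * (c 1%N - 2) = tau.

Local Notation "\S_ m F" := (\sum_(1 <= m < N.+1) F)
  (at level 36, m name, F at level 36).

Let K := \S_m (m%:R * u m).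
Let A s := \sum_(1 <= m < N.+1 | (m < s)%N) (m%:R * (s%:R - m%:R) * u m).
Let B s := \sum_(1 <= m < N.+1 | (s < m)%N) (m%:R * (m%:R - s%:R) * u m).

(** For c_j = 2 cosh(jz) this is the Fejér kernel (sinh(mz/2) / sinh(z/2))^2. It follows by summing
    the recursion c_(k+2) = c_(k+1) c_1 - c_k twice; [T] and [P] are the two successive sums. *)
Lemma fejer_sum m : S * (c m - 2) =
  tau * (m%:R + \sum_(1 <= j < m) (m%:R - j%:R) * c j).
Proof.
pose T m := \sum_(1 <= j < m.+1) c j.
pose P m := \sum_(1 <= j < m) (m%:R - j%:R) * c j.
have PS k : P k.+1 = P k + T k.
  rewrite /P /T; case: k => [|k]; first by rewrite !big_geq ?addr0.
  rewrite [LHS]big_nat_recr //= [\sum_(1 <= j < k.+2) c j]big_nat_recr //= addrA -big_split /=.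
  rewrite -!natr1; congr (_ + _); last by ring.
  by apply: eq_bigr => j _; ring.
have TS k : T k.+1 = T k + c k.+1 by rewrite /T big_nat_recr.
have T0 : T 0%N = 0 by rewrite /T big_geq.
have tauT k : S * (c k.+1 - c k) = tau * (1 + T k).
  elim: k => [|k IH]; first by rewrite T0 c0 S_tau; ring.
  have := c_mul k 1; rewrite !addn1 => cc.
  have -> : S * (c k.+2 - c k.+1) = S * (c k.+1 - c k) + S * (c 1%N - 2) * c k.+1.
    have -> : c k.+2 = c k.+1 * c 1%N - c k by rewrite cc; ring.
    by ring.
  by rewrite IH S_tau TS; ring.
elim: m => [|m IH]; first by rewrite c0 big_geq //; ring.
rewrite -/(P m) in IH; rewrite -/(P m.+1) PS -natr1.
have -> : S * (c m.+1 - 2) = S * (c m - 2) + S * (c m.+1 - c m) by ring.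
by rewrite IH tauT; ring.
Qed.

Lemma sum_mul_cubic s :
  (\sum_(1 <= m < N.+1 | (m < s)%N) m%:R * (s%:R - m%:R)) *+ 6 =
  (s%:R ^+ 3 - s%:R : L) \/ (N < s)%N.
Proof.
have [Ns|sN] := ltnP N s; [by right|left].
have -> : \sum_(1 <= m < N.+1 | (m < s)%N) m%:R * (s%:R - m%:R) =
    \sum_(1 <= m < s) m%:R * (s%:R - m%:R) :> L.
  by rewrite [RHS](big_nat_widen _ _ N.+1) //; lia.
have H k (x : L) : (\sum_(1 <= m < k) m%:R * (x - m%:R)) *+ 6 =
    k%:R * (k%:R - 1) * (x *+ 3 - (k%:R *+ 2 - 1)).
  elim: k => [|k IH]; first by rewrite big_geq // mul0rn !mul0r.
  case: k IH => [|k] IH; first by rewrite big_geq // mul0rn subrr mulr0 mul0r.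
  by rewrite big_nat_recr //= mulrnDl IH -!natr1; ring.
by rewrite H; ring.
Qed.

(** The relation for m and s linearizes the product: u_m u_(m+s) = u_s u_m - (u_s + 1) u_(m+s). The
    weight m (m + s) = 2 s m + m (m - s) gives 2 s K - A + B in the first sum, and shifting m + s to
    m gives B in the second. *)
Lemma conv_shift s : \S_ m (m%:R * (m + s)%:R * (u m * u (m + s)%N)) =
  u s * (2 * s%:R * K - A s) - B s \/ s = 0%N.
Proof.
case: s => [|s]; [by right|left].
set t := s.+1.
have E m : (0 < m)%N -> m%:R * (m + t)%:R * (u m * u (m + t)%N) =
    u t * (m%:R * (m + t)%:R * u m) - (u t + 1) * (m%:R * (m + t)%:R * u (m + t)%N).
    move=> m0; have H := @u_mul m t m0 isT.
  have -> : u m * u (m + t)%N =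
    u (m + t)%N * (1 + u m + u t) - u (m + t)%N - u t * u (m + t)%N by ring.
  by rewrite -H; ring.
have -> : \S_ m (m%:R * (m + t)%:R * (u m * u (m + t)%N)) =
    u t * \S_ m (m%:R * (m + t)%:R * u m) -
    (u t + 1) * \S_ m (m%:R * (m + t)%:R * u (m + t)%N).
  rewrite !mulr_sumr -sumrB; apply: eq_big_nat => m /andP[m0 _].
  exact: E.
have -> : \S_ m (m%:R * (m + t)%:R * u (m + t)%N) = B t.
  rewrite (@sum_nat_shift _ (fun m => m%:R * (m + t)%:R * u (m + t)%N) N t).
    by apply: eq_bigr => m tm; rewrite subnK ?natrB ?(ltnW tm) //; ring.
  by move=> n Nn; rewrite u_big // mulr0.
have -> : \S_ m (m%:R * (m + t)%:R * u m) = 2 * t%:R * K - A t + B t.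
  transitivity (2 * t%:R * K + \S_ m (m%:R * (m%:R - t%:R) * u m)).
    by rewrite mulr_sumr -big_split; apply: eq_bigr => m _ /=; rewrite natrD; ring.
  rewrite -addrA; congr (_ + _).
  rewrite (bigID (fun m => (m < t)%N)) /=; congr (_ + _).
    by rewrite -sumrN; apply: eq_bigr => m _; ring.
  rewrite (bigID (fun m => m == t)) /= big1 ?add0r; last first.
    by move=> m /andP[_ /eqP->]; rewrite subrr mulr0 mul0r.
  by apply: eq_bigl => m; lia.
by ring.
Qed.

Let V := \S_ m (m%:R * u m * (c m - 2)).

(** After u_m u_n = u_(m+n) (1 + u_m + u_n), symmetry replaces the bracket by 1 + 2 u_m. Grouping by
    s = m + n leaves the sum of m (s - m), which is (s^3 - s) / 6; hence the factor 6. *)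
Lemma sum_triangle : (\S_ m \S_ n (m%:R * n%:R * (u m * u n) * c (m + n)%N)) *+ 6 =
  \S_ s (c s * u s * (s%:R ^+ 3 - s%:R + 12 * A s)).
Proof.
pose G m n := m%:R * n%:R * u (m + n)%N * c (m + n)%N.
have -> : \S_ m \S_ n (m%:R * n%:R * (u m * u n) * c (m + n)%N) =
    \S_ m \S_ n (G m n * (1 + 2 * u m)).
  have -> : \S_ m \S_ n (G m n * (1 + 2 * u m)) =
      \S_ m \S_ n (G m n * (1 + u m)) + \S_ m \S_ n (G m n * u n).
    rewrite [X in _ + X]exchange_big -big_split; apply: eq_bigr => m _ /=.
    rewrite -big_split; apply: eq_bigr => n _ /=.
    by rewrite /G (addnC n m); ring.
  rewrite -big_split; apply: eq_big_nat => m /andP[m0 _] /=.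
  rewrite -big_split; apply: eq_big_nat => n /andP[n0 _] /=.
  by rewrite u_mul // /G; ring.
have -> : \S_ m \S_ n (G m n * (1 + 2 * u m)) = \S_ m
    (\sum_(1 <= s < N.+1 | (m < s)%N) (m%:R * (s%:R - m%:R) * u s * c s * (1 + 2 * u m))).
  apply: eq_bigr => m _.
  rewrite (@sum_nat_shift _ (fun n => G m n * (1 + 2 * u m)) N m); last first.
    by move=> n Nn; rewrite /G addnC u_big // mulr0 !mul0r.
  by apply: eq_bigr => s ms; rewrite /G subnKC ?natrB ?(ltnW ms).
rewrite (exchange_big_dep xpredT) //= -sumrMnl; apply: eq_big_nat => s /andP[s0 sN].
have [<-|] := sum_mul_cubic s; last by lia.
have -> : \sum_(1 <= m < N.+1 | (m < s)%N)
      (m%:R * (s%:R - m%:R) * u s * c s * (1 + 2 * u m)) =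
    u s * c s * (\sum_(1 <= m < N.+1 | (m < s)%N) m%:R * (s%:R - m%:R)) +
    2 * u s * c s * A s.
  by rewrite /A !mulr_sumr -big_split; apply: eq_bigr => m _ /=; ring.
by ring.
Qed.

(** Expand by c_m c_n = c_(m+n) + c_|m-n|. The part with m + n is left for [sum_triangle], the
    diagonal contributes c_0 = 2, and the part with the difference s is evaluated by
    [conv_shift]. *)
Lemma sum_cos_sqr : (\S_ m (m%:R * u m * c m)) ^+ 2 =
  \S_ m (m%:R ^+ 2 * u m ^+ 2) *+ 2 +
  \S_ m \S_ n (m%:R * n%:R * (u m * u n) * c (m + n)%N) +
  (\S_ s (c s * (u s * (2 * s%:R * K - A s) - B s))) *+ 2.
Proof.
have -> : (\S_ m (m%:R * u m * c m)) ^+ 2 =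
    \S_ m \S_ n (m%:R * u m * c m * (n%:R * u n * c n)).
  by rewrite expr2 mulr_suml; apply: eq_bigr => m _; rewrite mulr_sumr.
rewrite sum_nat_sym; [|by move=> *; ring|by move=> m n ?; rewrite (u_big (m := n)) //; ring].
rewrite [X in _ = _ + X + _]sum_nat_sym; last 2 first.
- by move=> m n; rewrite (addnC n m); ring.
- by move=> m n ?; rewrite (u_big (m := n)) //; ring.
have -> : \S_ m (m%:R * u m * c m * (m%:R * u m * c m)) =
    \S_ m (m%:R ^+ 2 * u m ^+ 2) *+ 2 + \S_ m (m%:R * m%:R * (u m * u m) * c (m + m)%N).
  rewrite -sumrMnl -big_split; apply: eq_bigr => m _ /=.
  have := c_mul 0 m; rewrite c0 !add0n => cc.
  transitivity (m%:R ^+ 2 * u m ^+ 2 * (c m * c m)); first by ring.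
  by rewrite cc; ring.
have -> : \S_ s \S_ m (m%:R * u m * c m * ((m + s)%:R * u (m + s)%N * c (m + s)%N)) =
    \S_ s \S_ m (m%:R * (m + s)%:R * (u m * u (m + s)%N) * c (m + (m + s))%N) +
    \S_ s (c s * (u s * (2 * s%:R * K - A s) - B s)).
  rewrite -big_split; apply: eq_big_nat => s /andP[s0 _] /=.
  have [<-|] := conv_shift s; last by lia.
  rewrite mulr_sumr -big_split; apply: eq_bigr => m _ /=.
  transitivity (m%:R * u m * ((m + s)%:R * u (m + s)%N) * (c (s + m)%N * c m)).
    by rewrite (addnC s m); ring.
  by rewrite c_mul (addnC s m) (addnC m (m + s)%N); ring.
by ring.
Qed.

(** This is the second-order equation of wp with its q = 0 part subtracted. [fejer_sum] turns S V
    into finite sums; after the squares are expanded, all terms in A, B and K attached to a c_s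
    cancel, and only the cubes m^3 survive. *)
Lemma ramanujan_identity :
  tau * \S_ m (m%:R ^+ 3 * u m * c m) =
  12 * S * V + tau * V + 6 * tau * V ^+ 2 +
  tau * (2 * K - 24 * K ^+ 2 - 12 * \S_ m (m%:R ^+ 2 * (u m + u m ^+ 2))).
Proof.
have VE : V = \S_ m (m%:R * u m * c m) - 2 * K.
  by rewrite mulr_sumr -sumrB; apply: eq_bigr => m _; ring.
have SV : S * V = tau * (\S_ m (m%:R ^+ 2 * u m) + \S_ s (c s * B s)).
  have -> : \S_ s (c s * B s) = \S_ m
     (m%:R * u m * \sum_(1 <= j < N.+1 | (j < m)%N) (m%:R - j%:R) * c j).
    under eq_bigr do rewrite mulr_sumr.
    rewrite (exchange_big_dep xpredT) //=; apply: eq_bigr => m _.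
    by rewrite mulr_sumr; apply: eq_bigr => j _; ring.
  rewrite mulr_sumr -big_split mulr_sumr; apply: eq_big_nat => m /andP[_ mN] /=.
  have -> : \sum_(1 <= j < N.+1 | (j < m)%N) (m%:R - j%:R) * c j =
      \sum_(1 <= j < m) (m%:R - j%:R) * c j.
    by rewrite [RHS](big_nat_widen _ _ N.+1) //; lia.
  transitivity (m%:R * u m * (S * (c m - 2))); first by ring.
  by rewrite fejer_sum; ring.
have -> : 12 * S * V = 12 * (S * V) by ring.
have -> : 6 * tau * V ^+ 2 = tau * ((\S_ m (m%:R * u m * c m)) ^+ 2 *+ 6
    - 24 * K * \S_ m (m%:R * u m * c m) + 24 * K ^+ 2) by rewrite VE; ring.
rewrite sum_cos_sqr !mulrnDl sum_triangle SV VE.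
have -> : \S_ m (m%:R ^+ 2 * (u m + u m ^+ 2)) =
    \S_ m (m%:R ^+ 2 * u m) + \S_ m (m%:R ^+ 2 * u m ^+ 2).
  by rewrite -big_split; apply: eq_bigr => m _ /=; ring.
have H : \S_ m (m%:R ^+ 3 * u m * c m) =
   12 * \S_ s (c s * B s) + \S_ m (m%:R * u m * c m) +
   \S_ s (c s * u s * (s%:R ^+ 3 - s%:R + 12 * A s)) +
   12 * \S_ s (c s * (u s * (2 * s%:R * K - A s) - B s)) -
   24 * K * \S_ m (m%:R * u m * c m).
  move: K => k; rewrite !mulr_sumr -!big_split -sumrB; apply: eq_bigr => m _ /=; ring.
by rewrite H; ring.
Qed.
End Ramanujan.

(** * Bernoulli numbers and hyperbolic functions *)

Lemma size_bern_seq n : size (bern_seq n) = n.+1.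
Proof. by elim: n => // n IH; rewrite size_rcons IH. Qed.

Lemma nth_bern_seq n i : (i <= n)%N -> (bern_seq n)`_i = bernoulli i.
Proof.
elim: n => [|n IH]; first by rewrite leqn0 => /eqP->.
rewrite leq_eqVlt => /predU1P[->//|i_n].
by rewrite /= nth_rcons size_bern_seq i_n IH.
Qed.

Lemma bernoulliS n : bernoulli n.+1 =
  - (n.+2%:R)^-1 * \sum_(j < n.+1) ('C(n.+2, j))%:R * bernoulli j.
Proof.
rewrite {1}/bernoulli /= nth_rcons size_bern_seq ltnn eqxx.
by congr (_ * _); apply: eq_bigr => j _; rewrite nth_bern_seq // -ltnS.
Qed.

Section FpsMap.
Variables (A B : comNzRingType) (phi : {rmorphism A -> B}).
Definition fps_map (f : fps A) : fps B := fun n => phi (f n).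
Lemma fps_map_is_zmod_morphism : zmod_morphism fps_map.
Proof. by move=> f g; apply/funext => n; rewrite /fps_map fpsD fpsN rmorphB. Qed.
Lemma fps_map_is_monoid_morphism : monoid_morphism fps_map.
Proof.
split=> [|f g]; apply/funext => n; rewrite /fps_map.
  by rewrite !fps1 rmorph_nat.
by rewrite !fpsM rmorph_sum; apply: eq_bigr => i _; rewrite rmorphM.
Qed.
HB.instance Definition _ := GRing.isZmodMorphism.Build (fps A) (fps B) fps_map
  fps_map_is_zmod_morphism.
HB.instance Definition _ := GRing.isMonoidMorphism.Build (fps A) (fps B) fps_map
  fps_map_is_monoid_morphism.
Lemma fps_map_theta f : fps_map (fps_theta f) = fps_theta (fps_map f).
Proof. by apply/funext => n; rewrite /fps_map /fps_theta rmorphMn. Qed.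
Lemma fps_mapX : fps_map (@fpsX A) = @fpsX B.
Proof. by apply/funext => n; rewrite /fps_map /fpsX rmorph_nat. Qed.
End FpsMap.

Definition fps_exp (r : rat) : fps rat := fun n => r ^+ n / n`!%:R.

Lemma natr_fact_neq0 n : n`!%:R != 0 :> rat.
Proof. by rewrite pnatr_eq0 -lt0n fact_gt0. Qed.

Lemma binr_fact n i : (i <= n)%N ->
  ('C(n, i))%:R = n`!%:R / (i`!%:R * (n - i)`!%:R) :> rat.
Proof.
move=> i_n; rewrite -(bin_fact i_n) !natrM mulfK //.
Qed.

Lemma fps_expD r s : fps_exp (r + s) = fps_exp r * fps_exp s.
Proof.
apply/funext => n; rewrite fpsM /fps_exp addrC exprDn mulr_suml.
apply: eq_bigr => i _; rewrite -mulr_natr binr_fact -1?ltnS //.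
rewrite !invfM; field; rewrite !natr_fact_neq0 //.
Qed.

Lemma fps_exp0 : fps_exp 0 = 1.
Proof. by apply/funext => -[|n]; rewrite fps1 /fps_exp expr0n ?mul0r //= divr1. Qed.

Lemma fps_theta_exp r : fps_theta (fps_exp r) = fpsC r * fpsX rat * fps_exp r.
Proof.
apply/funext => n; rewrite -mulrA fpsCM fpsXM /fps_theta /fps_exp.
case: n => [|n]; first by rewrite mulr0.
rewrite factS natrM exprS -mulr_natr; field.
by rewrite natr_fact_neq0 addrC natr1 pnatr_eq0.
Qed.

Definition bern_fps : fps rat := fun n => bernoulli n / n`!%:R.

Lemma bern_fps_exp : bern_fps * (fps_exp 1 - 1) = fpsX rat.
Proof.
apply/funext => n; rewrite fpsM big_ord_recr /= subnn.
have -> : (fps_exp 1 - 1) 0%N = 0 by rewrite fpsD fpsN fps1 /fps_exp divr1 subrr.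
rewrite mulr0 addr0; case: n => [|n]; first by rewrite big_ord0.
transitivity (n.+1`!%:R^-1 * \sum_(i < n.+1) ('C(n.+1, i))%:R * bernoulli i).
  rewrite mulr_sumr; apply: eq_bigr => i _.
  rewrite binr_fact ?(ltnW (ltn_ord i)) // fpsD fpsN fps1 subn_eq0 leqNgt ltn_ord /=.
  rewrite /bern_fps /fps_exp expr1n; field.
  by rewrite !natr_fact_neq0.
case: n => [|n]; first by rewrite big_ord1 /fpsX /= mulr1.
rewrite big_ord_recr /= binSn /fpsX eqSS.
rewrite bernoulliS.
rewrite mulrA mulrN divff ?pnatr_eq0 //.
by rewrite mulN1r subrr mulr0.
Qed.

(** Logarithmic derivative of b = x / (e - 1), using x e / (e - 1) = x + b. *)
Lemma bern_fps_riccati :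
  fps_theta bern_fps = bern_fps - fpsX rat * bern_fps - bern_fps ^+ 2.
Proof.
set b := bern_fps; set x := fpsX rat; set e := fps_exp 1.
have be : b * (e - 1) = x := bern_fps_exp.
have te : fps_theta e = x * e by rewrite fps_theta_exp rmorph1 mul1r.
have tx : fps_theta x = x by rewrite -[x]expr1 fps_thetaXn.
have t1 : fps_theta (1 : fps rat) = 0 by rewrite -(rmorph1 (@fpsC rat)) fps_thetaC.
have H : fps_theta b * (e - 1) = x - b * (x * e).
  by have := congr1 (@fps_theta _) be; rewrite fps_thetaM raddfB /= te t1 tx => E;
    rewrite -[X in _ = X - _]E; ring.
(* The series e - 1 has no constant term, so it is not inverted: multiply by x = b (e - 1) instead
   and cancel x, which is regular. *)
apply: (@fpsXn_lreg _ 1); rewrite /= expr1 -/x.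
transitivity (b * (e - 1) * fps_theta b); first by rewrite be.
transitivity (b * (fps_theta b * (e - 1))); first by ring.
rewrite H; transitivity (b * x - b * x * (b * (e - 1) + b)); first by ring.
by rewrite be; ring.
Qed.

(* z^2 / (4 sinh^2 (z/2)), as [bern_fps] is z / (e^z - 1) *)
Definition csch2_fps : fps rat := bern_fps - fps_theta bern_fps.

Lemma csch2_fpsE : csch2_fps = bern_fps ^+ 2 + fpsX rat * bern_fps.
Proof. by rewrite /csch2_fps bern_fps_riccati; ring. Qed.

(* 2 cosh (m z) *)
Definition fps_cosh2 (m : nat) : fps rat := fps_exp m%:R + fps_exp (- m%:R).

Lemma fps_cosh20 : fps_cosh2 0 = 2.
Proof. by rewrite /fps_cosh2 oppr0 fps_exp0; ring. Qed.

Lemma fps_cosh2M m n : fps_cosh2 (m + n) * fps_cosh2 n =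
  fps_cosh2 (m + n + n) + fps_cosh2 m.
Proof.
rewrite /fps_cosh2 mulrDl !mulrDr -!fps_expD !natrD.
have -> : m%:R + n%:R - n%:R = m%:R :> rat by ring.
have -> : - (m%:R + n%:R) + n%:R = - m%:R :> rat by ring.
have -> : - (m%:R + n%:R) - n%:R = - (m%:R + n%:R + n%:R) :> rat by ring.
ring.
Qed.

Lemma fps_cosh2E m n :
  fps_cosh2 m n = if odd n then 0 else 2 * m%:R ^+ n / n`!%:R.
Proof.
rewrite /fps_cosh2 fpsD /fps_exp exprNn -signr_odd.
by case: (odd n); rewrite ?expr1 ?expr0; ring.
Qed.

Lemma csch2_cosh2 : csch2_fps * (fps_cosh2 1 - 2) = fpsX rat ^+ 2.
Proof.
rewrite csch2_fpsE /fps_cosh2.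
set b := bern_fps; set x := fpsX rat; set e := fps_exp 1; set e' := fps_exp (- 1).
have be : b * (e - 1) = x := bern_fps_exp.
have ee' : e * e' = 1 by rewrite -fps_expD subrr fps_exp0.
have -> : e + e' - 2 = e' * (e - 1) ^+ 2.
  transitivity (e * (e * e') - 2 * (e * e') + e'); last by ring.
  by rewrite ee'; ring.
transitivity (e' * (b * (e - 1)) * (b * (e - 1) + x * (e - 1))); first by ring.
rewrite be; transitivity (x ^+ 2 * (e * e')); first by ring.
by rewrite ee' mulr1.
Qed.

Lemma fps_thetaX (K : comNzRingType) : fps_theta (fpsX K) = fpsX K.
Proof. by rewrite -[fpsX K]expr1 fps_thetaXn. Qed.

(** For s = 1 / (4 sinh^2 (z/2)) this is s'' = 6 s^2 + s, the equation of wp at q = 0 up to an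
    additive constant. The Riccati equation closes the polynomials in x and b under [fps_theta], so
    only a polynomial identity remains. *)
Lemma csch2_fps_ode :
  fps_theta (fps_theta csch2_fps) - fps_theta csch2_fps *+ 5 + csch2_fps *+ 6 =
  6 * csch2_fps ^+ 2 + fpsX rat ^+ 2 * csch2_fps.
Proof.
rewrite csch2_fpsE expr2.
do 6! rewrite ?raddfD ?raddfB ?raddfN /= ?fps_thetaM ?fps_thetaX ?bern_fps_riccati ?expr2.
ring.
Qed.

Lemma fps_theta_cosh2 m : fps_theta (fps_theta (fps_cosh2 m)) - fps_theta (fps_cosh2 m) =
  m%:R ^+ 2 * fpsX rat ^+ 2 * fps_cosh2 m.
Proof.
rewrite /fps_cosh2 !raddfD /= !fps_theta_exp !fps_thetaM !fps_thetaC !fps_thetaX.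
by rewrite !fps_theta_exp !rmorphN !rmorph_nat /=; ring.
Qed.

(** * The Weierstrass function *)

Section Weierstrass.
Variables (K : comAlgType rat) (u : nat -> K) (N : nat).
Hypothesis u_mul : forall m n, (0 < m)%N -> (0 < n)%N ->
  u m * u n = u (m + n)%N * (1 + u m + u n).
Hypothesis u_big : forall m, (N < m)%N -> u m = 0.

Local Notation iota := (fps_map (in_alg K)).
Local Notation X := (fpsX K).
Local Notation theta := (@fps_theta K).
Let S : fps K := iota csch2_fps.
Let c m : fps K := iota (fps_cosh2 m).
Let V : fps K := \sum_(1 <= m < N.+1) (m%:R * fpsC (u m) * (c m - 2)).
Let w : fps K := fpsC (in_alg K (12%:R^-1)).

(* z^2 times the Weierstrass function; [V + w] is the part coming from the
   nonzero powers of q, and [w] = 1/12 cancels the constant term. *)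
Definition wp_fps : fps K := S + X ^+ 2 * (V + w).
Local Notation F := wp_fps.

Let C := 2 * (\sum_(1 <= m < N.+1) m%:R * u m)
  - 24 * (\sum_(1 <= m < N.+1) m%:R * u m) ^+ 2
  - 12 * \sum_(1 <= m < N.+1) m%:R ^+ 2 * (u m + u m ^+ 2).

Let w12 : 12 * w = 1.
Proof.
rewrite /w -(rmorph_nat (@fpsC K)) -(rmorph_nat (in_alg K)) -!rmorphM.
by rewrite divff // !rmorph1.
Qed.

Let thetaV : theta (theta V) - theta V =
  X ^+ 2 * \sum_(1 <= m < N.+1) (m%:R ^+ 3 * fpsC (u m) * c m).
Proof.
rewrite /V !raddf_sum /= -big_split mulr_sumr; apply: eq_bigr => m _ /=.
have tZ k f : theta (fpsC k * f) = fpsC k * theta f.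
  by rewrite fps_thetaM fps_thetaC mul0r add0r.
have t2 : theta (c m - 2) = theta (c m).
  by rewrite raddfB /= -(rmorph_nat (@fpsC K)) fps_thetaC subr0.
have := congr1 iota (fps_theta_cosh2 m).
rewrite rmorphB /= !fps_map_theta !(rmorphXn, rmorphM) /= fps_mapX rmorph_nat.
rewrite -/(c m) => H.
have -> : m%:R * fpsC (u m) = fpsC (m%:R * u m) by rewrite rmorphM rmorph_nat.
rewrite !tZ t2 -mulrBr H rmorphM rmorph_nat; ring.
Qed.

(** For F = z^2 wp the left side is (theta - 2)(theta - 3) F = z^4 wp'', so this is wp'' = 6 wp^2 -
    a. *)
Lemma wp_fps_ode_const : exists a : K,
  theta (theta F) - theta F *+ 5 + F *+ 6 = 6 * F ^+ 2 - X ^+ 4 * fpsC a.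
Proof.
(* The first term is the constant 6 w^2 from squaring S + X^2 (V + w); [C] is the constant in
   [ramanujan_identity]. *)
exists (6 * in_alg K (12%:R^-1) ^+ 2 - C).
have HS : theta (theta S) - theta S *+ 5 + S *+ 6 = 6 * S ^+ 2 + X ^+ 2 * S.
  rewrite /S; move: csch2_fps csch2_fps_ode => f /(congr1 iota).
  rewrite !(rmorph_nat, rmorphB, rmorphXn, rmorphM, rmorphD, rmorphMn) /=.
  by rewrite !fps_map_theta fps_mapX => H; rewrite -H; ring.
have -> : fpsC (6 * in_alg K (12%:R^-1) ^+ 2 - C) = 6 * w ^+ 2 - fpsC C.
  by rewrite rmorphB rmorphM rmorphXn rmorph_nat.
have CE : fpsC C = 2 * (\sum_(1 <= m < N.+1) m%:R * fpsC (u m))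
  - 24 * (\sum_(1 <= m < N.+1) m%:R * fpsC (u m)) ^+ 2
  - 12 * \sum_(1 <= m < N.+1) m%:R ^+ 2 * (fpsC (u m) + fpsC (u m) ^+ 2).
  rewrite !(rmorphB, rmorphM, rmorphXn, rmorph_nat, rmorph_sum) /=.
  congr (_ * _ - _ * _ ^+ 2 - _ * _); apply: eq_bigr => m _;
    by rewrite !(rmorphM, rmorphD, rmorphXn, rmorph_nat).
have HV : X ^+ 2 * \sum_(1 <= m < N.+1) (m%:R ^+ 3 * fpsC (u m) * c m) =
    12 * S * V + X ^+ 2 * V + 6 * X ^+ 2 * V ^+ 2 + X ^+ 2 * fpsC C.
  rewrite CE; apply: ramanujan_identity.
  - by move=> m n m0 n0; rewrite -rmorphM u_mul // !(rmorphM, rmorphD, rmorph1).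
  - by move=> m Nm; rewrite u_big // rmorph0.
  - by rewrite /c fps_cosh20 rmorph_nat.
  - by move=> m n; rewrite /c -rmorphM fps_cosh2M rmorphD.
  - rewrite /S /c; move: csch2_fps (fps_cosh2 1) csch2_cosh2 => f g /(congr1 iota).
    by rewrite rmorphM rmorphB rmorphXn rmorph_nat /= fps_mapX.
have tX2 f : theta (X ^+ 2 * f) = X ^+ 2 * (f *+ 2 + theta f).
  by rewrite fps_thetaM fps_thetaXn; ring.
have -> : theta (theta F) - theta F *+ 5 + F *+ 6 =
   (theta (theta S) - theta S *+ 5 + S *+ 6) + X ^+ 2 * (theta (theta V) - theta V).
  have tw : theta w = 0 by apply: fps_thetaC.
  have tD f g : theta (f + g) = theta f + theta g by rewrite raddfD.
  rewrite /wp_fps tD tX2 (tD V) tw addr0 (tD (theta S)) tX2 tD.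
  by rewrite mulr2n !tD tw addr0; ring.
rewrite HS thetaV HV.
(* The equations of [S] and [V] each leave a linear term; since 12 w = 1, these are exactly the
   cross terms 12 w S and 12 w V of the square. *)
have E : X ^+ 4 * V = X ^+ 4 * V * (12 * w) by rewrite w12 mulr1.
have E' : X ^+ 2 * S = X ^+ 2 * S * (12 * w) by rewrite w12 mulr1.
rewrite /wp_fps.
transitivity (6 * S ^+ 2 + X ^+ 2 * S + 12 * X ^+ 2 * S * V + X ^+ 4 * V +
  6 * X ^+ 4 * V ^+ 2 + X ^+ 4 * fpsC C); first by ring.
by rewrite E {1}E'; ring.
Qed.
End Weierstrass.

(** * 2-integrality *)

(** Membership in Z_(2). Any odd multiplier is allowed, not only the reduced denominator, so that
    closure under sums and products is immediate. *)
Definition int2 (r : rat) : Prop :=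
  exists m (d : nat), odd d /\ r * d%:R = (m : int)%:~R.

Lemma int2_int (m : int) : int2 m%:~R.
Proof. by exists m, 1%N; rewrite mulr1. Qed.

Lemma int2_nat n : int2 n%:R.
Proof. by rewrite pmulrn; apply: int2_int. Qed.

Lemma int2_N1 : int2 (-1).
Proof. exact: (int2_int (-1)). Qed.

Lemma int2D r s : int2 r -> int2 s -> int2 (r + s).
Proof.
move=> [m [d [od E]]] [m' [d' [od' E']]]; exists (m * d'%:Z + m' * d%:Z), (d * d')%N.
split; first by rewrite oddM od.
by rewrite intrD !intrM -E -E' -!pmulrn natrM; ring.
Qed.

Lemma int2M r s : int2 r -> int2 s -> int2 (r * s).
Proof.
move=> [m [d [od E]]] [m' [d' [od' E']]]; exists (m * m'), (d * d')%N.
split; first by rewrite oddM od.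
by rewrite intrM -E -E' natrM; ring.
Qed.

Lemma int2_invodd n : odd n -> int2 (n%:R^-1).
Proof.
move=> on; exists 1, n; split=> //.
by rewrite mulVf // pnatr_eq0; case: n on.
Qed.

Lemma int2_nu_ge0 r : int2 r -> nu_ge0 2 r.
Proof.
move=> [m [d [od E]]]; rewrite /nu_ge0 /nu; case: eqP => // _.
suff: odd `|denq r|%N.
  by move=> H; rewrite (lognE 2 `|denq r|%N) dvdn2 H !andbF subr0.
have {}E : numq r * d%:Z = m * denq r.
  apply: (@intr_inj rat); rewrite !intrM -E -pmulrn.
  transitivity ((numq r)%:~R / (denq r)%:~R * d%:R * (denq r)%:~R : rat).
    by rewrite mulrAC mulfVK // intr_eq0 denq_neq0.
  by rewrite divq_num_den.
have : (denq r %| numq r * d%:Z)%Z by rewrite E dvdz_mull.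
rewrite Gauss_dvdzr; last by rewrite coprimezE coprime_sym coprime_num_den.
rewrite dvdzE /= => /dvdnP[k dk].
by move: od; rewrite dk oddM => /andP[].
Qed.

Section Span.
Variables (K : comAlgType rat) (x y : K).

(** The Z_(2)-span of the monomials of weight j, as explicit lists of terms. No independence is
    presupposed; for j odd only 0 belongs to it. *)
Inductive span2 (j : nat) : K -> Prop :=
| span2_0 : span2 j 0
| span2_cons r a b z : int2 r -> (4 * a + 6 * b = j)%N -> span2 j z ->
    span2 j (r *: (x ^+ a * y ^+ b) + z).

Lemma span2D j z t : span2 j z -> span2 j t -> span2 j (z + t).
Proof.
move=> Hz Ht; elim: Hz => [|r a b z0 Hr E _ IH]; first by rewrite add0r.
by rewrite -addrA; apply: span2_cons.
Qed.

Lemma span2Z j r z : int2 r -> span2 j z -> span2 j (r *: z).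
Proof.
move=> Hr; elim=> [|r' a b z0 Hr' E _ IH]; first by rewrite scaler0; left.
by rewrite scalerDr scalerA; apply: span2_cons => //; apply: int2M.
Qed.

Lemma span2_sum j I (s : seq I) (P : pred I) (f : I -> K) :
  (forall i, P i -> span2 j (f i)) -> span2 j (\sum_(i <- s | P i) f i).
Proof. by move=> H; apply: big_ind => //; [left|exact: span2D]. Qed.

Lemma span2M i j z t : span2 i z -> span2 j t -> span2 (i + j) (z * t).
Proof.
move=> Hz Ht; elim: Hz => [|r a b z0 Hr E _ IH]; first by rewrite mul0r; left.
rewrite mulrDl; apply: span2D => //; elim: Ht => [|r' a' b' t0 Hr' E' _ IH'].
  by rewrite mulr0; left.
rewrite mulrDr; apply: span2D => //.
have -> : r *: (x ^+ a * y ^+ b) * (r' *: (x ^+ a' * y ^+ b')) =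
  (r * r') *: (x ^+ (a + a') * y ^+ (b + b')) + 0.
  by rewrite -scalerAl -scalerAr scalerA addr0 !exprD; congr (_ *: _); ring.
by apply: span2_cons; [exact: int2M|lia|left].
Qed.

Lemma span2_odd j z : odd j -> span2 j z -> z = 0.
Proof. by move=> oj; case=> // r a b t _ E; move: oj; rewrite -E; lia. Qed.

Lemma span2_gen4 r : int2 r -> span2 4 (r *: x).
Proof.
move=> Hr; have -> : r *: x = r *: (x ^+ 1 * y ^+ 0) + 0 by rewrite mulr1 addr0.
by apply: span2_cons => //; left.
Qed.

Lemma span2_gen6 r : int2 r -> span2 6 (r *: y).
Proof.
move=> Hr; have -> : r *: y = r *: (x ^+ 0 * y ^+ 1) + 0 by rewrite mul1r addr0.
by apply: span2_cons => //; left.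
Qed.

(** Vanishing constant terms remove both end terms of the convolution. So coefficients below j
    control the product up to j included, as strong induction requires. *)
Lemma span2_fpsM (f g : fps K) j : f 0%N = 0 -> g 0%N = 0 ->
  (forall i, (i < j)%N -> span2 i (f i)) -> (forall i, (i < j)%N -> span2 i (g i)) ->
  forall i, (i <= j)%N -> span2 i ((f * g) i).
Proof.
move=> f0 g0 Hf Hg i ij; rewrite fpsM; apply: span2_sum => k _.
have ki : (k <= i)%N by rewrite -ltnS.
have [->|k0] := posnP (k : nat); first by rewrite f0 mul0r; left.
have [->|ki'] := eqVneq (k : nat) i; first by rewrite subnn g0 mulr0; left.
rewrite -{1}(subnKC ki); apply: span2M; [apply: Hf|apply: Hg]; lia.
Qed.
End Span.

Lemma alg_mulrn_eq0 (K : comAlgType rat) (z : K) n : (0 < n)%N -> z *+ n = 0 -> z = 0.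
Proof.
move=> n0 E; rewrite -[z]scale1r -(@mulVf _ (n%:R : rat)) ?pnatr_eq0 -?lt0n //.
by rewrite -scalerA scaler_nat E scaler0.
Qed.

(** * The first-order equation and the 2-integral recurrence *)

Section FirstIntegral.
Variables (K : comAlgType rat) (F : fps K) (a : K).
Local Notation X := (fpsX K).
Local Notation theta := (@fps_theta K).
Hypothesis F0 : F 0%N = 1.
Hypothesis F1 : F 1%N = 0.
Hypothesis F2 : F 2%N = 0.
Hypothesis ode :
  theta (theta F) - theta F *+ 5 + F *+ 6 = 6 * F ^+ 2 - X ^+ 4 * fpsC a.

Let ode_coef n : F n *+ (n * n) - F n *+ (n * 5) + F n *+ 6 =
  6 * (F ^+ 2) n - (if n == 4%N then a else 0).
Proof.
have := congr1 (fun f => f n) ode.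
have -> : 6 * F ^+ 2 = fpsC 6 * F ^+ 2 by rewrite rmorph_nat.
rewrite !(fpsD, fpsN, fpsMn) fpsCM /fps_theta -!mulrnA => ->.
congr (_ - _); rewrite fpsXnM /fpsC; have [n4|n4|<-//] := ltngtP 4 n.
  by rewrite subn_eq0 leqNgt n4.
by [].
Qed.

Let F3 : F 3%N = 0.
Proof.
(* The left factor (n - 2)(n - 3) vanishes at n = 3, and the right side is 12 F_3. *)
apply: (@alg_mulrn_eq0 _ _ 12) => //.
transitivity (F 3 *+ (3 * 3) - F 3 *+ (3 * 5) + F 3 *+ 6); last by ring.
rewrite ode_coef expr2 fpsM !big_ord_recl big_ord0 /= F0 F1 F2 /bump /=; ring.
Qed.

Let a_eq : a = 10 * F 4%N.
Proof.
transitivity (12 * F 4%N - (F 4 *+ (4 * 4) - F 4 *+ (4 * 5) + F 4 *+ 6)); last by ring.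
rewrite ode_coef expr2 fpsM !big_ord_recl big_ord0 /= F0 F1 F2 F3 /bump /=; ring.
Qed.

(* [W], the difference of the two sides, is z^6 times a constant since
   [theta W = W *+ 6]; the constant is read off the coefficient of z^6. *)
Lemma first_integral :
  (theta F - F *+ 2) ^+ 2 =
  4 * F ^+ 3 - 20 * X ^+ 4 * fpsC (F 4%N) * F - 28 * X ^+ 6 * fpsC (F 6%N).
Proof.
set A := fpsC (F 4%N); set B := fpsC (F 6%N).
apply/eqP; rewrite -subr_eq0; apply/eqP.
set W := (X in X = 0).
have thD f g : theta (f + g) = theta f + theta g by rewrite raddfD.
have thN f : theta (- f) = - theta f by rewrite raddfN.
have thC f k : theta (f * fpsC k) = theta f * fpsC k.
  by rewrite fps_thetaM fps_thetaC mulr0 addr0.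
have thk k f : theta (k%:R * f) = k%:R * theta f.
  by rewrite -(rmorph_nat (@fpsC K)) mulrC thC mulrC.
have thX n f : theta (X ^+ n * f) = X ^+ n * (n%:R * f + theta f).
  by rewrite fps_thetaM fps_thetaXn; ring.
have aE : fpsC a = 10 * A by rewrite a_eq rmorphM rmorph_nat.
have thW : theta W = W *+ 6.
  set G := theta F - F *+ 2 in W *.
  have tF : theta F = G + 2 * F by rewrite /G; ring.
  have tG : theta G = 3 * G + 6 * F ^+ 2 - X ^+ 4 * (10 * A).
    rewrite -aE; transitivity (theta (theta F) - 2 * theta F).
      by rewrite /G raddfB /= raddfMn /=; ring.
    transitivity (3 * G + (theta (theta F) - theta F *+ 5 + F *+ 6)).
      by rewrite /G; ring.
    by rewrite ode; ring.
  have tGG : theta (G ^+ 2) = 2 * G * theta G by rewrite expr2 fps_thetaM; ring.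
  have tFF : theta (4 * F ^+ 3) = 12 * F ^+ 2 * theta F.
    by rewrite thk exprS expr2 !fps_thetaM; ring.
  have tA : theta (20 * X ^+ 4 * A * F) = 20 * X ^+ 4 * A * (4 * F + theta F).
    have -> : 20 * X ^+ 4 * A * F = 20 * (X ^+ 4 * (F * A)) by ring.
    by rewrite thk thX thC; ring.
  have tB : theta (28 * X ^+ 6 * B) = 6 * (28 * X ^+ 6 * B).
    have -> : 28 * X ^+ 6 * B = 28 * (X ^+ 6 * B) by ring.
    by rewrite thk thX fps_thetaC; ring.
  rewrite /W thD tGG tG thN !thD !thN tFF tA tB tF; ring.
have W6 : W 6%N = 0.
  rewrite /W.
  have -> : (theta F - F *+ 2) ^+ 2 - (4 * F ^+ 3 - 20 * X ^+ 4 * A * F - 28 * X ^+ 6 * B) =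
     (theta F - F *+ 2) * (theta F - F *+ 2) - fpsC 4 * (F * (F * F)) +
     fpsC 20 * (X ^+ 4 * (A * F)) + fpsC 28 * (X ^+ 6 * B).
    by rewrite !rmorph_nat; ring.
  rewrite !(fpsD, fpsN) !fpsCM !fpsXnM /= /A /B fpsCM F2.
  do 3! rewrite ?fpsM ?big_ord_recl ?big_ord0 /=.
  rewrite !(fpsD, fpsN, fpsMn) /fps_theta /bump /addn /subn /fpsC /= F0 F1 F2 F3; ring.
apply/funext => n; have := congr1 (fun f => f n) thW.
rewrite fpsMn /fps_theta => E.
have [lt|gt|->] := ltngtP n 6%N; last exact: W6.
  apply: (@alg_mulrn_eq0 _ _ (6 - n)); first by rewrite subn_gt0.
  by rewrite mulrnBr ?(ltnW lt) // E subrr.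
apply: (@alg_mulrn_eq0 _ _ (n - 6)); first by rewrite subn_gt0.
by rewrite mulrnBr ?(ltnW gt) // E subrr.
Qed.

(** Strong induction on the coefficient of z^j in the first integral divided by 4: theta P + P = H^2
    - 3 P^2 - P^3 + 5 F_4 z^4 F + 7 F_6 z^6. The left side gives (j + 1) F_j; for j even j + 1 is
    odd, and for j odd the span is zero. *)
Lemma span2_coef (x y : K) : F 4%N = 3 * x -> F 6%N = 5 * y ->
  forall j, (0 < j)%N -> span2 x y j (F j).
Proof.
move=> F4 F6 j; elim/ltn_ind: j => j IH j0.
(* Here theta F - 2 F = 2 (H - 1). The half in [H] costs no 2-integrality, because the coefficients
   of odd index vanish. *)
pose P : fps K := F - 1; pose H : fps K := fun n => (n%:R / 2 - 1 : rat) *: P n.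
have PE i : (0 < i)%N -> P i = F i by case: i => // i _; rewrite /P fpsD fpsN fps1 subr0.
have P0 : P 0%N = 0 by rewrite /P fpsD fpsN fps1 F0 subrr.
have H0 : H 0%N = 0 by rewrite /H P0 scaler0.
have HP i : (i < j)%N -> span2 x y i (P i).
  by case: i => [|i] ij; rewrite ?P0 ?PE //; [left|apply: IH].
have HH i : (i < j)%N -> span2 x y i (H i).
  move=> ij; have := HP i ij; rewrite /H; case: (boolP (odd i)) => oi.
    by move/(span2_odd oi)->; rewrite scaler0; left.
  apply: span2Z; rewrite -(odd_double_half i) (negPf oi) add0n -muln2 natrM.
  by rewrite mulfK //; apply: int2D; [apply: int2_nat|apply: int2_N1].
have HPP := span2_fpsM P0 P0 HP HP.
have PP0 : (P * P) 0%N = 0 by rewrite fpsM big_ord1 P0 mul0r.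
have HPPP := span2_fpsM PP0 P0 (fun i ij => HPP i (ltnW ij)) HP (leqnn j).
have HHH := span2_fpsM H0 H0 HH HH (leqnn j).
have spann n z : span2 x y j z -> span2 x y j (n%:R * z).
  by move=> Hz; rewrite mulr_natl -scaler_nat; apply: span2Z; first exact: int2_nat.
have Fj : F j = P j by rewrite PE.
have E : j.+1%:R * F j = (H * H) j - (3%:R * (P * P) j + (P * P * P) j) +
   ((5 * F 4%N) * (X ^+ 4 * F) j + 7 * (X ^+ 6 * fpsC (F 6%N)) j).
  have FP : F = P + 1 by rewrite /P subrK.
  have H2 : 2 * H = theta P - P *+ 2.
    apply/funext => i; rewrite -(rmorph_nat (@fpsC K)) fpsCM /H fpsD fpsN fpsMn /fps_theta.
    have sn (z : K) n : z *+ n = (n%:R : rat) *: z by rewrite scaler_nat.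
    rewrite mulr_natl !sn -scalerBl scalerA.
    by congr (_ *: _); field.
  have tP : theta F = theta P.
    by rewrite [in LHS]FP raddfD /= -(rmorph1 (@fpsC K)) fps_thetaC addr0.
  pose Z := fpsC 4 * (theta P + P - (H * H - (fpsC 3 * (P * P) + P * P * P) +
     (fpsC (5 * F 4%N) * (X ^+ 4 * F) + fpsC 7 * (X ^+ 6 * fpsC (F 6%N))))).
  have Z0 : Z = 0.
    have -> : Z = 4 * F ^+ 3 - 20 * X ^+ 4 * fpsC (F 4%N) * F -
        28 * X ^+ 6 * fpsC (F 6%N) - (theta F - F *+ 2) ^+ 2.
      rewrite /Z rmorphM !rmorph_nat tP /=.
      have -> : theta P = 2 * H + P *+ 2 by rewrite H2 subrK.
      move: (fpsC (F 4)) (fpsC (F 6)) => A B.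
      by rewrite FP; ring.
    by rewrite first_integral subrr.
  apply/eqP; rewrite -subr_eq0; apply/eqP; apply: (@alg_mulrn_eq0 _ _ 4) => //.
  have := congr1 (fun f => f j) Z0; rewrite /Z fps0 fpsCM mulr_natl => Zj; rewrite -[RHS]Zj.
  rewrite !(fpsD, fpsN) !fpsCM Fj /fps_theta; congr (_ *+ _); ring.
have Sj : span2 x y j (j.+1%:R * F j).
  rewrite E; apply: span2D; [apply: span2D => //|apply: span2D].
  - rewrite -scaleN1r; apply: span2Z; first exact: int2_N1.
    by apply: span2D => //; apply: spann; apply: HPP.
  - rewrite fpsXnM F4; have [j4|_] := leqP 4 j; last by rewrite mulr0; left.
    rewrite -{1}(subnKC j4); apply: span2M.
      have -> : 5 * (3 * x) = (15 : rat) *: x by rewrite scaler_nat; ring.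
      exact: span2_gen4 (int2_nat 15).
    have [->|] := posnP (j - 4)%N; last by move=> ?; apply: IH => //; lia.
    by rewrite F0; have := span2_cons (x := x) (y := y) (int2_nat 1) (erefl : (4 * 0 + 6 * 0 = 0)%N)
      (span2_0 _ _ 0); rewrite addr0 scale1r mulr1.
  - rewrite fpsXnM F6 /fpsC; have [j6|_] := leqP 6 j; last by rewrite mulr0; left.
    have [j6'|_] := eqVneq (j - 6)%N 0%N; last by rewrite mulr0; left.
    have -> : j = 6%N by lia.
    have -> : 7 * (5 * y) = (35 : rat) *: y by rewrite scaler_nat; ring.
    exact: span2_gen6 (int2_nat 35).
have -> : F j = ((j.+1)%:R^-1 : rat) *: (j.+1%:R * F j).
  by rewrite mulr_natl -scaler_nat scalerA mulVf ?scale1r // pnatr_eq0.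
have [oj|ej] := boolP (odd j); last by apply: span2Z => //; apply: int2_invodd.
by rewrite (span2_odd oj Sj) scaler0; left.
Qed.
End FirstIntegral.

Lemma bernoulli1 : bernoulli 1 = - 2^-1.
Proof. by rewrite /bernoulli /= big_ord1 /= bin0; field. Qed.

Lemma bernoulli2 : bernoulli 2 = 6^-1.
Proof. by rewrite /bernoulli /= !big_ord_recl !big_ord0 /= !bin0 binS bin1 bin0 ; field. Qed.

Lemma fpsCE (K : comNzRingType) (c : K) n : fpsC c n = if n == 0%N then c else 0.
Proof. by []. Qed.

(** * Eisenstein series as Taylor coefficients of wp *)

Section Moments.
Variables (K : comAlgType rat) (u : nat -> K) (N : nat).
Hypothesis u_mul : forall m n, (0 < m)%N -> (0 < n)%N ->
  u m * u n = u (m + n)%N * (1 + u m + u n).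
Hypothesis u_big : forall m, (N < m)%N -> u m = 0.

(* G_k, up to the power (- T)^(k/2) of the transcendental factor *)
Definition eis (k : nat) : K := (- bernoulli k / k`!%:R)%:A +
  (2 / k.-1`!%:R : rat) *: \sum_(1 <= m < N.+1) (m%:R ^+ k.-1 * u m).

Let wp_coef j : wp_fps u N j = (csch2_fps j)%:A +
  (if (2 <= j)%N then
     (\sum_(1 <= m < N.+1) m%:R * u m * ((fps_cosh2 m (j - 2)%N)%:A - 2 *+ (j == 2)%N))
       + (12%:R^-1)%:A *+ (j == 2)%N else 0).
Proof.
rewrite /wp_fps fpsD; congr (_ + _); rewrite fpsXnM; case: ifP => // j2.
rewrite fpsD fps_sum; congr (_ + _).
  apply: eq_bigr => m _; rewrite -(rmorph_nat (@fpsC K)) -rmorphM fpsCM fpsD fpsN.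
  congr (_ * (_ - _)).
  by rewrite -(rmorph_nat (@fpsC K)) /= fpsCE subn_eq0 eqn_leq j2 andbT; case: ifP.
by rewrite fpsCE subn_eq0 eqn_leq j2 andbT; case: ifP.
Qed.

Let csch2_coef j : csch2_fps j = (1 - j%:R) * bernoulli j / j`!%:R.
Proof. by rewrite /csch2_fps fpsD fpsN /fps_theta /bern_fps -mulr_natr; ring. Qed.

Lemma wp_fps0 : wp_fps u N 0%N = 1.
Proof. by rewrite wp_coef csch2_coef addr0 fact0 divr1 subr0 mulr1 scale1r. Qed.

Lemma wp_fps1 : wp_fps u N 1%N = 0.
Proof. by rewrite wp_coef csch2_coef addr0 subrr !mul0r scale0r. Qed.

Lemma wp_fps2 : wp_fps u N 2%N = 0.
Proof.
rewrite wp_coef csch2_coef /= big1 => [|m _].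
  rewrite add0r -scalerDl bernoulli2.
  by have -> : (1 - 2) * 6^-1 / 2`!%:R + 12%:R^-1 = 0 :> rat by []; rewrite scale0r.
by rewrite fps_cosh2E subnn fact0 /= expr0 mulr1 scaler_nat mulr1n subrr mulr0.
Qed.

(** Both parts carry k - 1: [csch2_fps] has coefficient (1 - k) B_k / k!, and 2 cosh(mz) contributes
    2 m^(k-2) / (k-2)! = (k - 1) 2 m^(k-2) / (k-1)!. *)
Lemma wp_fps_even k : (4 <= k)%N -> ~~ odd k ->
  wp_fps u N k = (k.-1%:R : rat) *: eis k.
Proof.
move=> k4 ek; rewrite wp_coef csch2_coef (leq_trans _ k4) //.
have -> : (k == 2)%N = false by apply/eqP; lia.
rewrite mulr0n addr0 /eis scalerDr !scalerA; congr (_ + _).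
  congr (_ *: _). have -> : k%:R = k.-1%:R + 1 :> rat by rewrite natr1 prednK //; lia.
  by ring.
rewrite scaler_sumr; apply: eq_bigr => m _.
rewrite ?mulr0n subr0 fps_cosh2E oddB; last lia.
rewrite (negPf ek) /=.
case: k k4 ek => [|[|k]] // _ _; rewrite /= subn2 /=.
have -> : k.+1%:R * (2 / k.+1`!%:R) = 2 / k`!%:R :> rat.
  rewrite factS natrM; field.
  by rewrite natr_fact_neq0 addrC natr1 pnatr_eq0.
have -> : (2 * m%:R ^+ k / k`!%:R)%:A = (2 / k`!%:R : rat) *: (m%:R ^+ k) :> K.
  rewrite -[m%:R ^+ k in RHS]natrX -[(m ^ k)%:R in RHS]scaler_nat scalerA natrX.
  by congr (_ *: _); ring.
by rewrite -scalerAr exprS; congr (_ *: _); ring.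
Qed.

(** The values 3 and 5 of k - 1 at weights 4 and 6 are those expected by [span2_coef]; the odd
    factor k - 1 is divided out at the end. *)
Lemma eis_span2 k : (4 <= k)%N -> ~~ odd k -> span2 (eis 4) (eis 6) k (eis k).
Proof.
move=> k4 ek; have [a ode] := wp_fps_ode_const u_mul u_big.
have := span2_coef wp_fps0 wp_fps1 wp_fps2 ode (x := eis 4) (y := eis 6) _ _ (j := k).
rewrite !wp_fps_even // !scaler_nat !mulr_natl => /(_ erefl erefl) H.
have -> : eis k = (k.-1%:R^-1 : rat) *: (eis k *+ k.-1).
  by rewrite -scaler_nat scalerA mulVf ?scale1r // pnatr_eq0; lia.
apply: span2Z; last by apply: H; lia.
by apply: int2_invodd; lia.
Qed.
End Moments.

Section SpanSum.
Variables (K : comAlgType rat) (x y : K) (k : nat).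

Lemma span2_sumE z : span2 x y k z -> exists p : nat -> rat,
  (forall a, int2 (p a)) /\
  z = \sum_(0 <= a < (k %/ 4).+1 | (6 %| k - 4 * a)%N)
        p a *: (x ^+ a * y ^+ ((k - 4 * a) %/ 6)).
Proof.
elim=> [|r a b t Hr E _ [p [Hp ->]]].
  exists (fun _ => 0); split; first by move=> _; exact: (int2_nat 0).
  by rewrite big1 // => a _; rewrite scale0r.
exists (fun i => (if i == a then r else 0) + p i); split.
  by move=> i; apply: int2D => //; case: ifP => // _; exact: (int2_nat 0).
rewrite [RHS](eq_bigr (fun i => (if i == a then r *: (x ^+ a * y ^+ b) else 0) +
    p i *: (x ^+ i * y ^+ ((k - 4 * i) %/ 6)))); last first.
  move=> i _; rewrite scalerDl; congr (_ + _); case: eqP => [->|_]; last by rewrite scale0r.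
  by congr (_ *: (_ * _ ^+ _)); lia.
rewrite big_split -big_mkcondr; congr (_ + _).
rewrite (eq_bigl (fun i => i == a)); last by move=> i; case: eqP => [->|]; lia.
by rewrite big_nat1_eq ifT //; lia.
Qed.
End SpanSum.

(** * Truncated q-series *)

Section Truncation.
Variable N : nat.

(* Working modulo q^(N+1) turns the Lambert series into finite sums. *)
Definition qtrunc := {poly %/ ('X^(N.+1) : {poly rat})}.
HB.instance Definition _ := GRing.ComAlgebra.on qtrunc.

Local Notation inQ := (@in_qpoly rat 'X^(N.+1) : {poly rat} -> qtrunc).

Lemma in_qpoly_eqP (p q : {poly rat}) :
  (forall i, (i <= N)%N -> p`_i = q`_i) <-> inQ p = inQ q.
Proof.
have E r : (inQ r : {poly rat}) = take_poly N.+1 r.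
  rewrite -{1}(poly_take_drop N.+1 r) /in_qpoly /= mk_monic_Xn /=.
  rewrite Pdiv.RingMonic.rmodpD ?monicXn // Pdiv.RingMonic.rmodp_mull ?monicXn // addr0.
  by rewrite Pdiv.Ring.rmodp_small // size_polyXn ltnS size_take_poly.
split=> [H|/(congr1 (fun z : qtrunc => (z : {poly rat}))) H i iN].
  apply/val_inj; rewrite /= -[LHS]/(inQ p : {poly rat}) -[RHS]/(inQ q : {poly rat}) !E.
  apply/polyP => i; rewrite !coef_take_poly; case: ifP => // iN.
  by apply: H.
by move/(congr1 (fun z : {poly rat} => z`_i)): H; rewrite !E !coef_take_poly ltnS iN.
Qed.

Definition qtr (f : qexp rat) : qtrunc := inQ (\poly_(i < N.+1) f i).

Lemma qtr_eqP f g : (forall i, (i <= N)%N -> f i = g i) <-> qtr f = qtr g.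
Proof.
rewrite -in_qpoly_eqP; split=> H i iN; first by rewrite !coef_poly ltnS iN H.
by have := H i iN; rewrite !coef_poly ltnS iN.
Qed.

Lemma qtrD f g : qtr (fun n => f n + g n) = qtr f + qtr g.
Proof.
rewrite /qtr -rmorphD; apply/in_qpoly_eqP => i iN.
by rewrite coefD !coef_poly ltnS iN.
Qed.

Lemma qtrZ c f : qtr (fun n => c * f n) = c *: qtr f.
Proof.
rewrite /qtr -in_qpolyZ; apply/in_qpoly_eqP => i iN.
by rewrite coefZ !coef_poly ltnS iN.
Qed.

Lemma qtr0 : qtr (fun=> 0) = 0.
Proof.
rewrite /qtr -(in_qpoly0 'X^(N.+1)); apply/in_qpoly_eqP => i iN.
by rewrite coef0 !coef_poly ltnS iN.
Qed.

Lemma qtr_sum I (s : seq I) (P : pred I) (f : I -> qexp rat) :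
  qtr (fun n => \sum_(i <- s | P i) f i n) = \sum_(i <- s | P i) qtr (f i).
Proof.
elim: s => [|i s IH].
  by rewrite big_nil -qtr0; congr qtr; apply/funext => n; rewrite big_nil.
rewrite big_cons; case: ifP => Pi; rewrite -IH -?qtrD; congr qtr;
  by apply/funext => n; rewrite big_cons Pi.
Qed.

Lemma qtr1 : qtr qone = 1.
Proof.
rewrite /qtr -(in_qpoly1 'X^(N.+1)); apply/in_qpoly_eqP => i iN.
by rewrite coef_poly ltnS iN coef1 /qone; case: (i == 0%N).
Qed.

Lemma qtrM f g : qtr (qmul f g) = qtr f * qtr g.
Proof.
rewrite /qtr -in_qpolyM; apply/in_qpoly_eqP => i iN.
rewrite coef_poly ltnS iN coefM; apply: eq_bigr => j _.
have ji : (j <= i)%N by rewrite -ltnS.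
by rewrite !coef_poly !ltnS (leq_trans ji iN) (leq_trans (leq_subr _ _) iN).
Qed.

Lemma qtrX f m : qtr (qpow f m) = qtr f ^+ m.
Proof. by elim: m => [|m IH]; rewrite ?qtr1 //= exprS -IH -qtrM. Qed.

(* q^m / (1 - q^m) *)
Definition qlambert (m : nat) : qtrunc := qtr (fun i => ((0 < i)%N && (m %| i)%N)%:R).

Lemma qlambertE m : (0 < m)%N -> (1 - inQ 'X ^+ m) * qlambert m = inQ 'X ^+ m.
Proof.
move=> m0; rewrite /qlambert /qtr -rmorphXn -(in_qpoly1 'X^(N.+1)) -rmorphB -rmorphM.
apply/in_qpoly_eqP => i iN; rewrite mulrBl mul1r coefB coefXnM coefXn !coef_poly.
rewrite !ltnS iN (leq_trans (leq_subr _ _) iN) subn_gt0.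
have [im|mi|->] := ltngtP i m.
- rewrite subr0; case: i im {iN} => // i im.
  by rewrite gtnNdvd.
- by rewrite (leq_trans _ mi) // dvdn_subl ?(ltnW mi) // subrr.
- by rewrite m0 dvdnn subr0.
Qed.

Lemma qlambertM m n : (0 < m)%N -> (0 < n)%N ->
  qlambert m * qlambert n = qlambert (m + n) * (1 + qlambert m + qlambert n).
Proof.
move=> m0 n0; set t := inQ 'X.
have E k : (0 < k)%N -> (1 - t ^+ k) * (1 + qlambert k) = 1.
  by move=> k0; rewrite mulrDr qlambertE // mulr1 subrK.
have Em := E m m0; have En := E n n0; have Emn := E (m + n)%N (ltn_addr n m0).
have Lm := qlambertE m0; have Ln := qlambertE n0; have Lmn := qlambertE (ltn_addr n m0).
move: Em En Emn Lm Ln Lmn; rewrite -/t exprD.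
move: (t ^+ m) (t ^+ n) (qlambert m) (qlambert n) (qlambert (m + n)) => a b U W Y.
move=> Em En Emn Lm Ln Lmn; apply/eqP; rewrite -subr_eq0; apply/eqP.
(* Each 1 - q^k is invertible with inverse 1 + u_k. Inserting three such products, all equal to 1,
   clears the denominators. *)
transitivity (((1 - a) * (1 + U)) * ((1 - b) * (1 + W)) * ((1 - a * b) * (1 + Y)) *
   (U * W - Y * (1 + U + W))); first by rewrite Em En Emn !mul1r.
transitivity ((1 + U) * (1 + W) * (1 + Y) * (
   ((1 - a) * U) * ((1 - b) * W) * (1 - a * b) - ((1 - a * b) * Y) *
   ((1 - a) * (1 - b) + ((1 - a) * U) * (1 - b) + ((1 - b) * W) * (1 - a)))).
  by ring.
by rewrite Lm Ln Lmn; ring.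
Qed.

Lemma qlambert_big m : (N < m)%N -> qlambert m = 0.
Proof.
move=> Nm; rewrite /qlambert -qtr0; apply/qtr_eqP => -[|i] iN //=.
by rewrite gtnNdvd // (leq_ltn_trans iN).
Qed.

(** For 0 < n <= N all divisors of n lie in the range of m, so the coefficient of q^n collects m^r
    over exactly the divisors. *)
Lemma qlambert_moment r : \sum_(1 <= m < N.+1) (m%:R ^+ r * qlambert m) =
  qtr (fun n => if n == 0%N then 0 else (sigma r n)%:R).
Proof.
have E m : m%:R ^+ r * qlambert m =
   qtr (fun n => (m%:R ^+ r : rat) * ((0 < n)%N && (m %| n)%N)%:R).
  by rewrite qtrZ -natrX mulr_natl -natrX scaler_nat.
under eq_bigr do rewrite E.
rewrite -qtr_sum; apply/qtr_eqP => -[|n] nN.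
  by rewrite big1 // => m _; rewrite mulr0.
rewrite /= /sigma natr_sum.
rewrite [LHS](eq_bigr (fun m => if (m %| n.+1)%N then (m ^ r)%:R else 0)); last first.
  by move=> m _; rewrite natrX /=; case: (m %| _)%N; rewrite ?mulr1 ?mulr0.
rewrite -big_mkcond -big_filter; apply: perm_big; apply: uniq_perm.
- exact/filter_uniq/iota_uniq.
- exact: divisors_uniq.
- move=> d; rewrite mem_filter mem_index_iota -dvdn_divisors //.
  case: (boolP (d %| n.+1)%N) => //= dn.
  by rewrite (dvdn_gt0 _ dn) // ltnS (leq_trans (dvdn_leq _ dn)).
Qed.
End Truncation.

(** * Independence of the monomials *)

(* Y/W is not constant modulo q^2, so a form vanishing to order m+1 at q = 0
   has a root Y/W of multiplicity more than its degree m. *)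
Lemma forms_independent (Y W : {poly rat}) (m : nat) (v : nat -> rat) :
  Y`_0 != 0 -> W`_0 != 0 -> Y`_1 * W`_0 - Y`_0 * W`_1 != 0 ->
  'X^(m.+1) %| \sum_(j < m.+1) v j *: (Y ^+ j * W ^+ (m - j)) ->
  forall j, (j <= m)%N -> v j = 0.
Proof.
move=> Y0 W0 D0 H.
pose hom m (f : {poly rat}) := \sum_(j < m.+1) f`_j *: (Y ^+ j * W ^+ (m - j)).
suff S (f : {poly rat}) : (size f <= m.+1)%N -> 'X^(m.+1) %| hom m f -> f = 0.
  move=> j jm; have := S (\poly_(j < m.+1) v j) (size_poly _ _).
  have -> : hom m (\poly_(j < m.+1) v j) =
      \sum_(j < m.+1) v j *: (Y ^+ j * W ^+ (m - j)).
    by apply: eq_bigr => i _; rewrite coef_poly ltn_ord.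
  by move=> /(_ H) /(congr1 (fun p : {poly rat} => p`_j)); rewrite coef_poly ltnS jm coef0.
elim: m f {v H} => [|m IH] f sf H.
  have /dvdpP[q] := H; rewrite /hom big_ord1 !mulr1 => /(congr1 (fun p : {poly rat} => p`_0)).
  rewrite coefZ coef1 mulr1 coefMX /= => E.
  by rewrite (size1_polyC sf) E.
pose rho := Y`_0 / W`_0.
have f_rho : root f rho.
  have : (hom m.+1 f)`_0 = 0.
    by have /dvdpP[q ->] := H; rewrite coefMXn.
  rewrite -horner_coef0 /hom horner_sum => E.
  suff: W`_0 ^+ m.+1 * f.[rho] = 0.
    by move/eqP; rewrite mulf_eq0 expf_eq0 (negPf W0) andbF /= => /eqP/rootP.
  rewrite -[RHS]E (horner_coef_wide _ sf) mulr_sumr; apply: eq_bigr => i _.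
  rewrite hornerZ hornerM !horner_exp !horner_coef0 mulrCA; congr (_ * _).
  have im : (i <= m.+1)%N by rewrite -ltnS.
  have -> : W`_0 ^+ m.+1 = W`_0 ^+ (m.+1 - i) * W`_0 ^+ i by rewrite -exprD subnK.
  rewrite /rho expr_div_n; field.
  by rewrite expf_neq0.
have /factor_theorem[g fg] := f_rho.
have sg : (size g <= m.+1)%N.
  have [->|g0] := eqVneq g 0; first by rewrite size_poly0.
  by move: sf; rewrite fg size_Mmonic ?monicXsubC // size_XsubC addn2.
have homE : hom m.+1 f = (Y - rho *: W) * hom m g.
  rewrite mulrBl /hom !mulr_sumr.
  have -> : \sum_(i < m.+1) Y * (g`_i *: (Y ^+ i * W ^+ (m - i))) =
      \sum_(i < m.+2) (g * 'X)`_i *: (Y ^+ i * W ^+ (m.+1 - i)).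
    rewrite [RHS]big_ord_recl coefMX scale0r add0r; apply: eq_bigr => i _.
    by rewrite coefMX lift0 /= subSS exprS -mulrA -scalerAr.
  have -> : \sum_(i < m.+1) (rho *: W) * (g`_i *: (Y ^+ i * W ^+ (m - i))) =
      \sum_(i < m.+2) (rho * g`_i) *: (Y ^+ i * W ^+ (m.+1 - i)).
    rewrite [RHS]big_ord_recr /= nth_default // mulr0 scale0r addr0.
    apply: eq_bigr => i _; rewrite subSn -1?ltnS // exprS -scalerAl -scalerAr scalerA.
    by congr (_ *: _); ring.
  rewrite -sumrB; apply: eq_bigr => i _.
  by rewrite -scalerBl fg mulrBr coefB coefMC [rho * _]mulrC.
have [h hE] : exists h, Y - rho *: W = 'X * h.
  have : root (Y - rho *: W) 0.
    by rewrite rootE hornerD hornerN hornerZ !horner_coef0 divfK // subrr.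
  by move=> /factor_theorem[h ->]; exists h; rewrite subr0 mulrC.
have h0 : h`_0 != 0.
  have : ('X * h)`_1 = Y`_1 - rho * W`_1 by rewrite -hE coefB coefZ.
  rewrite coefXM /= => ->; apply: contraNneq D0 => E.
  by rewrite -[Y`_1](subrK (rho * W`_1)) E add0r mulrAC divfK // subrr.
suff g0 : g = 0 by rewrite fg g0 mul0r.
apply: IH => //; move: H; rewrite homE hE exprS -mulrA dvdp_mul2l ?polyX_eq0 //.
rewrite Gauss_dvdpr // coprimep_expl // coprimep_sym.
by rewrite coprimepX rootE horner_coef0.
Qed.


(** Solutions of 4a + 6b = k differ by multiples of (3, -2). The residues of a mod 3 and b mod 2 are
    thus fixed and their powers factor out, leaving a form of degree m in P^3 and Q^2; the third
    hypothesis says that P^3 / Q^2 has a nonzero linear term. *)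
Lemma monomials_independent (P Q : {poly rat}) (k : nat) (v : nat -> rat) :
  P`_0 != 0 -> Q`_0 != 0 -> 3 * P`_1 * Q`_0 - 2 * P`_0 * Q`_1 != 0 ->
  'X^(k.+1) %| \sum_(0 <= a < (k %/ 4).+1 | (6 %| k - 4 * a)%N)
     v a *: (P ^+ a * Q ^+ ((k - 4 * a) %/ 6)) ->
  forall a, (4 * a <= k)%N -> (6 %| k - 4 * a)%N -> v a = 0.
Proof.
move=> P0 Q0 D0 H a ak a6; pose b := ((k - 4 * a) %/ 6)%N.
have kab : k = (4 * a + 6 * b)%N by rewrite /b; lia.
pose m := (a %/ 3 + b %/ 2)%N.
have c0M (p q : {poly rat}) : (p * q)`_0 = p`_0 * q`_0 by rewrite coef0M.
have c1M (p q : {poly rat}) : (p * q)`_1 = p`_0 * q`_1 + p`_1 * q`_0.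
  by rewrite coefM !big_ord_recl big_ord0 addr0.
have cX0 (p : {poly rat}) n : (p ^+ n)`_0 = p`_0 ^+ n.
  by rewrite -!horner_coef0 horner_exp.
have E : \sum_(0 <= a < (k %/ 4).+1 | (6 %| k - 4 * a)%N)
     v a *: (P ^+ a * Q ^+ ((k - 4 * a) %/ 6)) =
   (P ^+ (a %% 3) * Q ^+ (b %% 2)) * \sum_(j < m.+1)
     v (a %% 3 + 3 * j)%N *: ((P ^+ 3) ^+ j * (Q ^+ 2) ^+ (m - j)).
  rewrite big_mkord mulr_sumr.
  have hk (j : 'I_m.+1) : (a %% 3 + 3 * j < (k %/ 4).+1)%N.
    by have := ltn_ord j; rewrite kab /m; lia.
  rewrite (reindex_onto (fun j : 'I_m.+1 => Ordinal (hk j))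
    (fun i : 'I_(k %/ 4).+1 => inord (i %/ 3))).
    apply: eq_big => [j|j _] /=.
      apply/andP; split; first by have := ltn_ord j; rewrite kab /m; lia.
      apply/eqP/val_inj; rewrite /= inordK; last by have := ltn_ord j; lia.
      by lia.
    rewrite -!exprM -scalerAr; congr (_ *: _).
    rewrite mulrACA -!exprD; congr (_ * _ ^+ _).
    by have := ltn_ord j; rewrite kab /m; lia.
  move=> i i6; apply/val_inj; rewrite /= inordK.
    by have := ltn_ord i; rewrite /m; lia.
  by have := ltn_ord i; lia.
have {}H : 'X^(m.+1) %| \sum_(j < m.+1)
     v (a %% 3 + 3 * j)%N *: ((P ^+ 3) ^+ j * (Q ^+ 2) ^+ (m - j)).
  have : ('X^(m.+1) : {poly rat}) %| 'X^(k.+1).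
    by apply: dvdp_exp2l; rewrite kab /m; lia.
  move/dvdp_trans/(_ H); rewrite E Gauss_dvdpr // coprimep_expl // coprimep_sym.
  by rewrite coprimepX rootE horner_coef0 c0M !cX0 mulf_neq0 // expf_neq0.
have := forms_independent (v := fun j => v (a %% 3 + 3 * j)%N) _ _ _ H.
rewrite !cX0 !expf_neq0 // => /(_ isT isT).
have c1sq (p : {poly rat}) : (p ^+ 2)`_1 = 2 * p`_0 * p`_1 by rewrite expr2 c1M; ring.
have c1cube (p : {poly rat}) : (p ^+ 3)`_1 = 3 * p`_0 ^+ 2 * p`_1.
  by rewrite exprS c1M c1sq cX0; ring.
rewrite c1sq c1cube.
have -> : 3 * P`_0 ^+ 2 * P`_1 * Q`_0 ^+ 2 - P`_0 ^+ 3 * (2 * Q`_0 * Q`_1) =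
   P`_0 ^+ 2 * Q`_0 * (3 * P`_1 * Q`_0 - 2 * P`_0 * Q`_1) by ring.
rewrite !mulf_neq0 ?expf_neq0 // => /(_ isT (a %/ 3)%N) Z.
have := Z _; have -> : (a %% 3 + 3 * (a %/ 3))%N = a by lia.
by apply; rewrite /m; lia.
Qed.

(* The q-expansion of [eis k] *)
Definition G_rat (k : nat) : qexp rat := fun n =>
  if n == 0%N then - bernoulli k / k`!%:R
  else 2 / k.-1`!%:R * (sigma k.-1 n)%:R.

Lemma G_rat0 k : G_rat k 0 = - bernoulli k / k`!%:R.
Proof. by []. Qed.

Lemma G_rat1 k : G_rat k 1 = 2 / k.-1`!%:R.
Proof. by rewrite /G_rat /= /sigma big_seq1 exp1n mulr1. Qed.

Lemma eis_qlambert N k : eis (qlambert N) N k = qtr N (G_rat k).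
Proof.
rewrite /eis qlambert_moment -qtr1 -!qtrZ -qtrD; apply/qtr_eqP => -[|n] _.
  by rewrite /qone /G_rat /= mulr1 mulr0 addr0.
by rewrite /qone /G_rat /= mulr0 add0r.
Qed.

Lemma bernoulli3 : bernoulli 3 = 0.
Proof.
by rewrite bernoulliS !big_ord_recl big_ord0 /= bernoulli1 bernoulli2.
Qed.
Lemma bernoulli4 : bernoulli 4 = - 30%:R^-1.
Proof.
by rewrite bernoulliS !big_ord_recl big_ord0 /= bernoulli1 bernoulli2 bernoulli3.
Qed.
Lemma bernoulli5 : bernoulli 5 = 0.
Proof.
by rewrite bernoulliS !big_ord_recl big_ord0 /= bernoulli1 bernoulli2 bernoulli3 bernoulli4.
Qed.
Lemma bernoulli6 : bernoulli 6 = 42%:R^-1.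
Proof.
by rewrite bernoulliS !big_ord_recl big_ord0 /= bernoulli1 bernoulli2
  bernoulli3 bernoulli4 bernoulli5.
Qed.

(** By signs alone: the first product is negative and the subtracted one positive. *)
Lemma bern46_neq0 (b4 b6 : rat) : b4 < 0 -> 0 < b6 ->
  3 * (2 / 4.-1`!%:R) * (- b6 / 6`!%:R) - 2 * (- b4 / 4`!%:R) * (2 / 6.-1`!%:R) != 0.
Proof.
move=> b4_lt0 b6_gt0; have fact_V r : 0 < r`!%:R^-1 :> rat.
  by rewrite invr_gt0 ltr0n fact_gt0.
apply: ltr0_neq0; rewrite subr_lt0; apply: (@lt_trans _ _ 0).
  by rewrite mulNr mulrN oppr_lt0; do !apply: mulr_gt0 => //; apply: fact_V.
by do !apply: mulr_gt0 => //; rewrite ?oppr_gt0 //; apply: fact_V.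
Qed.

(** Truncating at N = k gives a 2-integral expression with coefficients [p] modulo q^(k+1), the
    precision at which [monomials_independent] forces w = p. *)
Lemma G_rat_int2 k (w : nat -> rat) : (4 <= k)%N -> ~~ odd k ->
  (forall n, G_rat k n = \sum_(0 <= a < (k %/ 4).+1 | (6 %| k - 4 * a)%N)
     w a * qmul (qpow (G_rat 4) a) (qpow (G_rat 6) ((k - 4 * a) %/ 6)) n) ->
  forall a, (4 * a <= k)%N -> (6 %| k - 4 * a)%N -> int2 (w a).
Proof.
move=> k4 ek H.
have := eis_span2 (@qlambertM k) (@qlambert_big k) k4 ek.
rewrite !eis_qlambert => /span2_sumE[p [Hp E]].
have {}H : qtr k (G_rat k) = \sum_(0 <= a < (k %/ 4).+1 | (6 %| k - 4 * a)%N)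
     w a *: (qtr k (G_rat 4) ^+ a * qtr k (G_rat 6) ^+ ((k - 4 * a) %/ 6)).
  rewrite (_ : G_rat k = fun n => \sum_(0 <= a < (k %/ 4).+1 | (6 %| k - 4 * a)%N)
     w a * qmul (qpow (G_rat 4) a) (qpow (G_rat 6) ((k - 4 * a) %/ 6)) n); last first.
    exact/funext.
  by rewrite qtr_sum; apply: eq_bigr => a _; rewrite qtrZ qtrM !qtrX.
pose P r := \poly_(i < k.+1) G_rat r i.
have k1 : (1 < k.+1)%N by lia.
move=> a ak a6; suff -> : w a = p a by [].
apply/eqP; rewrite -subr_eq0; apply/eqP; move: a ak a6.
apply: (@monomials_independent (P 4) (P 6)).
- rewrite coef_poly G_rat0 bernoulli4 opprK; apply: mulf_neq0.
    by rewrite invr_eq0 pnatr_eq0.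
  by rewrite invr_eq0 natr_fact_neq0.
- rewrite coef_poly G_rat0 bernoulli6; apply: mulf_neq0.
    by rewrite oppr_eq0 invr_eq0 pnatr_eq0.
  by rewrite invr_eq0 natr_fact_neq0.
- rewrite !coef_poly k1 !G_rat0 !G_rat1; apply: bern46_neq0.
    by rewrite bernoulli4 oppr_lt0 invr_gt0 ltr0n.
  by rewrite bernoulli6 invr_gt0 ltr0n.
pose S := \sum_(0 <= a < (k %/ 4).+1 | (6 %| k - 4 * a)%N)
  (w a - p a) *: (P 4 ^+ a * P 6 ^+ ((k - 4 * a) %/ 6)).
have S0 : in_qpoly 'X^(k.+1) S = 0.
  rewrite /S raddf_sum -[RHS](subrr (qtr k (G_rat k))) {1}H E -sumrB.
  apply: eq_bigr => a _; rewrite /= in_qpolyZ rmorphM !rmorphXn -/(qtr k (G_rat 4)).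
  by rewrite -/(qtr k (G_rat 6)) -scalerBl.
have {}S0 i : (i <= k)%N -> S`_i = 0.
  by move: i; rewrite -(in_qpoly0 'X^(k.+1)) in S0;
    have /in_qpoly_eqP := S0 => Z i /Z; rewrite coef0.
rewrite -/S -(poly_take_drop k.+1 S).
have -> : take_poly k.+1 S = 0.
  by apply/polyP => i; rewrite coef_take_poly coef0; case: ifP => // ik; apply: S0.
by rewrite add0r dvdp_mull.
Qed.

(** * Zeta values at even integers *)

Section FiniteSums.
Variable R : realFieldType.

Definition zsum (N k : nat) : R := \sum_(1 <= n < N.+1) n%:R ^- k.
Local Notation h n := (zsum n 1).

Lemma hS N : h N.+1 = h N + N.+1%:R^-1.
Proof. by rewrite /zsum big_nat_recr. Qed.

Lemma sum_inv_diff_lt (a M : nat) : (M < a)%N ->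
  \sum_(1 <= b < M.+1) ((b%:R - a%:R)^-1 - (b%:R + a%:R)^-1) =
  h (a - M).-1 - h a.-1 - (h (a + M) - h a) :> R.
Proof.
elim: M => [|M IH] Ma; first by rewrite big_geq // subn0 addn0; ring.
have E1 : h (a - M).-1 = h (a - M.+1).-1 + (a%:R - M.+1%:R)^-1 :> R.
  have -> : (a - M).-1 = (a - M.+1).-1.+1 by lia.
  rewrite hS; congr (_ + _^-1); rewrite -natrB; last by lia.
  by congr (_%:R); lia.
have E2 : h (a + M.+1) = h (a + M) + (M.+1%:R + a%:R)^-1 :> R.
  by rewrite addnS hS -natrD; congr (_ + (_%:R)^-1); lia.
rewrite big_nat_recr //= IH ?(ltnW Ma) // E1 E2 -[a%:R - _]opprB invrN; ring.
Qed.

(* The term [b = a] contributes [- (2 a)^-1] because [0^-1 = 0]. *)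
Lemma sum_inv_diff (a N : nat) : (0 < a)%N -> (a <= N)%N ->
  \sum_(1 <= b < N.+1) ((b%:R - a%:R)^-1 - (b%:R + a%:R)^-1) =
  a%:R^-1 - (h (N + a) - h (N - a)) :> R.
Proof.
move=> a0; have a0' : a%:R != 0 :> R by rewrite pnatr_eq0; lia.
elim: N => [|N IH] aN; first by lia.
have [aN'|Na] := leqP a N.
  rewrite big_nat_recr //= IH // addSn subSn // !hS.
  by rewrite -subSn // natrB ?(leqW aN') // -addSn natrD; ring.
have -> : N.+1 = a by lia.
have aE : a = a.-1.+1 by lia.
rewrite {1}aE big_nat_recr //= sum_inv_diff_lt; last by lia.
rewrite -aE subrr invr0 subnn.
have -> : (a - a.-1).-1 = 0%N by lia.
have -> : (a + a)%N = (a + a.-1).+1 by lia.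
have Eh : h a = h a.-1 + a%:R^-1 by rewrite {1 3}aE hS.
have -> : h (a + a.-1).+1 = h (a + a.-1)%N + (a%:R + a%:R)^-1.
  by rewrite hS; congr (_ + _^-1); rewrite -natrD; congr (_%:R); lia.
by rewrite Eh; ring.
Qed.

(** Partial fractions give 1/2 of a^(-2). The term b = a is 0 on the left but -1/4 a^(-2) in the
    partial fractions; correcting it makes 3/4. *)
Lemma sum_inv_sqr_diff (a N : nat) : (0 < a)%N -> (a <= N)%N ->
  \sum_(1 <= b < N.+1) (b%:R ^+ 2 - a%:R ^+ 2)^-1 =
  3 / 4 * a%:R ^- 2 - (2 * a%:R)^-1 * (h (N + a) - h (N - a)) :> R.
Proof.
move=> a0 aN; have a0' : a%:R != 0 :> R by rewrite pnatr_eq0; lia.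
have -> : \sum_(1 <= b < N.+1) (b%:R ^+ 2 - a%:R ^+ 2)^-1 =
    \sum_(1 <= b < N.+1) ((2 * a%:R)^-1 * ((b%:R - a%:R)^-1 - (b%:R + a%:R)^-1) +
      if b == a then 4^-1 * a%:R ^- 2 else 0) :> R.
  apply: eq_big_nat => b /andP[b0 _]; case: eqP => [->|/eqP ba].
    by rewrite !subrr !invr0; field; rewrite a0' -natrD pnatr_eq0; lia.
  have ba' : b%:R - a%:R != 0 :> R by rewrite subr_eq0 eqr_nat.
  have ab' : b%:R + a%:R != 0 :> R by rewrite -natrD pnatr_eq0; lia.
  rewrite subr_sqr; field.
  by rewrite ba' ab' a0'.
rewrite big_split -mulr_sumr /= sum_inv_diff // -big_mkcond big_nat1_eq a0 ltnS aN.
by rewrite /=; field.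
Qed.

(* Off the diagonal, sum_j (a^(-2))^j (b^(-2))^(n-j) is a geometric sum with
   denominator b^2 - a^2, and the sum of 1/(b^2 - a^2) over b telescopes. *)
Lemma zsum_conv n N : (2 <= n)%N ->
  \sum_(1 <= j < n) zsum N (2 * j) * zsum N (2 * (n - j)) =
  (n%:R + 2^-1) * zsum N (2 * n) -
  \sum_(1 <= a < N.+1) a%:R ^- (2 * n.-1).+1 * (h (N + a) - h (N - a)).
Proof.
move=> n2; pose x (a : nat) : R := a%:R ^- 2.
have xE a k : a%:R ^- (2 * k) = x a ^+ k by rewrite /x exprM exprVn.
pose T a b := \sum_(1 <= j < n) x a ^+ j * x b ^+ (n - j).
have -> : \sum_(1 <= j < n) zsum N (2 * j) * zsum N (2 * (n - j)) =
    \sum_(1 <= a < N.+1) \sum_(1 <= b < N.+1) T a b.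
  rewrite (eq_bigr (fun j => \sum_(1 <= a < N.+1) \sum_(1 <= b < N.+1)
      x a ^+ j * x b ^+ (n - j))); last first.
    by move=> j _; rewrite /zsum big_distrlr; apply: eq_bigr => a _;
      apply: eq_bigr => b _; rewrite !xE.
  by rewrite exchange_big; apply: eq_bigr => a _; rewrite exchange_big.
have TE a b : (0 < a)%N -> (0 < b)%N -> T a b =
   (if b == a then (n.-1)%:R * x a ^+ n else 0) +
   (x a ^+ n.-1 - x b ^+ n.-1) * (b%:R ^+ 2 - a%:R ^+ 2)^-1.
  move=> a0 b0; have na (c : nat) : (0 < c)%N -> c%:R != 0 :> R by rewrite pnatr_eq0 lt0n.
  case: eqP => [->|/eqP ba].
    rewrite !subrr mul0r addr0 /T.
    rewrite (eq_big_nat _ _ (F2 := fun _ => x a ^+ n)); last first.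
      by move=> j /andP[_ jn]; rewrite -exprD subnKC // ltnW.
    by rewrite sumr_const_nat subn1 mulr_natl.
  have ba' : b%:R ^+ 2 - a%:R ^+ 2 != 0 :> R.
    rewrite subr_sqr mulf_neq0 //; first by rewrite subr_eq0 eqr_nat.
    by rewrite -natrD pnatr_eq0; lia.
  have ab : b%:R ^+ 2 - a%:R ^+ 2 = (x b)^-1 - (x a)^-1 by rewrite /x !invrK.
  rewrite add0r; apply: (canRL (mulfK ba')); rewrite ab mulr_suml.
  have xn0 c : (0 < c)%N -> x c != 0 by move=> c0; rewrite invr_eq0 expf_neq0 // na.
  rewrite (telescope_sumr_eq (fun j => x a ^+ j.-1 * x b ^+ (n - j))).
  - by rewrite subnn expr0 mulr1 expr0 mul1r subn1.
  - by rewrite ltnW.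
  - move=> j /andP[j1 jn] /=; have -> : (n - j)%N = (n - j.+1).+1 by lia.
    have -> : x a ^+ j = x a ^+ j.-1 * x a by rewrite -exprSr prednK.
    rewrite exprS; field; rewrite ?xn0 //.
pose D a b : R := (b%:R ^+ 2 - a%:R ^+ 2)^-1.
rewrite (eq_big_nat _ _ (F2 := fun a => (n.-1)%:R * x a ^+ n +
    (x a ^+ n.-1 * (\sum_(1 <= b < N.+1) D a b) +
     \sum_(1 <= b < N.+1) - (x b ^+ n.-1 * D a b)))); last first.
  move=> a /andP[a1 aN].
  rewrite (eq_big_nat _ _ (F2 := fun b => (if b == a then (n.-1)%:R * x a ^+ n else 0) +
   (x a ^+ n.-1 * D a b + - (x b ^+ n.-1 * D a b)))); last first.
    by move=> b /andP[b1 _]; rewrite TE // mulrBl.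
  by rewrite !big_split /= -big_mkcond big_nat1_eq a1 aN mulr_sumr.
rewrite !big_split /= [X in _ + (_ + X)]exchange_big /=.
(* [D] is antisymmetric, so this is a second copy of the first sum. The coefficient becomes (n - 1)
   + 2 (3/4) = n + 1/2. *)
have -> : \sum_(1 <= b < N.+1) \sum_(1 <= a < N.+1) - (x b ^+ n.-1 * D a b) =
    \sum_(1 <= a < N.+1) x a ^+ n.-1 * (\sum_(1 <= b < N.+1) D a b).
  apply: eq_bigr => a _; rewrite mulr_sumr; apply: eq_bigr => b _.
  by rewrite /D -mulrN -invrN opprB.
rewrite -big_split /= -big_split /= [zsum N (2 * n)]/zsum mulr_sumr -sumrB.
apply: eq_big_nat => a /andP[a1 aN].
have a0 : a%:R != 0 :> R by rewrite pnatr_eq0; lia.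
rewrite /D sum_inv_sqr_diff // xE.
have -> : a%:R ^- (2 * n.-1).+1 = x a ^+ n.-1 * a%:R^-1 :> R by rewrite exprSr invfM xE.
have -> : x a ^+ n = x a ^+ n.-1 * x a by rewrite -exprSr prednK; [|lia].
have -> : n%:R = n.-1%:R + 1 :> R by rewrite natr1 prednK; [|lia].
by move: (x a ^+ n.-1) => y; rewrite /x; field.
Qed.
End FiniteSums.

Section ZetaLimits.
Import numFieldNormedType.Exports.
Local Open Scope classical_set_scope.
Local Open Scope ring_scope.
Variable R : realType.
Local Notation zs N k := (@zsum R N k).

Lemma zsum_le N M k : (N <= M)%N -> zs N k <= zs M k.
Proof.
move=> NM; by rewrite /zsum [leRHS](@big_cat_nat _ _ _ N.+1) //= lerDl sumr_ge0.
Qed.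

Lemma zsum2_le N : zs N.+1 2 <= 2 - N.+1%:R^-1.
Proof.
elim: N => [|N IH]; first by rewrite /zsum big_nat1 expr1n invr1; lra.
rewrite /zsum big_nat_recr //=; apply: le_trans (lerD IH (lexx _)) _.
have N1 : 0 < N.+1%:R :> R by [].
have N2 : 0 < N.+2%:R :> R by [].
have E : N.+2%:R = N.+1%:R + 1 :> R by rewrite natr1.
rewrite -subr_ge0.
have -> : 2 - N.+2%:R^-1 - (2 - N.+1%:R^-1 + N.+2%:R ^- 2) =
   (N.+1%:R * N.+2%:R ^+ 2)^-1 :> R.
  by rewrite E; field; have := ler0n R N => N0; rewrite !gt_eqF //; lra.
by rewrite invr_ge0 mulr_ge0 ?exprn_ge0.
Qed.

Lemma zsum_le2 N k : (2 <= k)%N -> zs N k <= 2.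
Proof.
move=> k2; apply: le_trans (_ : zs N.+1 2 <= 2); last first.
  by apply: le_trans (zsum2_le N) _; rewrite gerBl invr_ge0.
apply: le_trans (zsum_le _ (leqnSn N)) _.
rewrite /zsum; rewrite big_nat [leRHS]big_nat; apply: ler_sum => i /andP[i1 _].
rewrite lef_pV2 ?posrE ?exprn_gt0 ?ltr0n //.
by rewrite -!natrX ler_nat leq_pexp2l.
Qed.

Lemma cvg_zsum k : (2 <= k)%N -> (fun N => zs N k) @ \oo --> (zeta k : R).
Proof.
move=> k2; suff : (fun N => \sum_(1 <= n < N) (n%:R : R) ^- k) @ \oo --> (zeta k : R).
  by rewrite -cvg_shiftS.
have nd : {homo (fun N => \sum_(1 <= n < N) (n%:R : R) ^- k) : n m / (n <= m)%N >-> n <= m}.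
  case=> [|n] [|m] nm //.
    by rewrite big_geq //; apply: sumr_ge0 => i _; rewrite invr_ge0 exprn_ge0.
  exact: zsum_le.
apply: nondecreasing_is_cvgn => //.
exists 2 => _ [[|N] _ <-]; first by rewrite big_geq.
exact: zsum_le2.
Qed.

Lemma zeta_ge1 k : (2 <= k)%N -> 1 <= zeta k :> R.
Proof.
move=> k2; apply: (cvgr_to_ge (cvg_zsum k2)); near=> N.
apply: (le_trans _ (zsum_le k (_ : 1 <= N)%N)).
  by rewrite /zsum big_nat1 expr1n invr1.
by near: N; exists 1%N.
Unshelve. all: by end_near. Qed.

Lemma zsum_diff_le N a : (a <= N)%N ->
  zs (N + a) 1 - zs (N - a) 1 <= (2 * a%:R) * (N - a).+1%:R^-1.
Proof.
move=> aN; rewrite /zsum (@big_cat_nat _ _ _ (N - a).+1) //=; last by lia.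
rewrite addrAC subrr add0r big_nat.
apply: (@le_trans _ _ (\sum_((N - a).+1 <= i < (N + a).+1 | ((N - a).+1 <= i < (N + a).+1)%N)
   (N - a).+1%:R^-1)).
  apply: ler_sum => i /andP[i1 _].
  by rewrite expr1 lef_pV2 ?posrE ?ltr0n ?ler_nat //; lia.
rewrite -big_nat sumr_const_nat -natrM -[leLHS]mulr_natl.
by rewrite ler_wpM2r ?invr_ge0 // ler_nat; lia.
Qed.

Definition zsum_err N n : R :=
  \sum_(1 <= a < N.+1) a%:R ^- (2 * n.-1).+1 * (zs (N + a) 1 - zs (N - a) 1).

Lemma zsum_err_ge0 N n : 0 <= zsum_err N n.
Proof.
apply: sumr_ge0 => a _; rewrite mulr_ge0 ?invr_ge0 ?exprn_ge0 // subr_ge0.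
by apply: zsum_le; lia.
Qed.

(** The harmonic difference has 2a terms, each at most 1/(N - a + 1), and the power of a is at most
    a^(-3). Since a (N - a + 1) >= N, each summand is at most 2 / (N a). *)
Lemma zsum_err_le N n : (0 < N)%N -> (2 <= n)%N ->
  zsum_err N n <= 2 * (N%:R^-1 * zs N 1).
Proof.
move=> N0 n2; rewrite /zsum_err /zsum !mulr_sumr big_nat [leRHS]big_nat.
apply: ler_sum => a /andP[a1 aN].
have a0 : 0 < a%:R :> R by rewrite ltr0n.
have N0' : 0 < N%:R :> R by rewrite ltr0n.
have H1 : a%:R ^- (2 * n.-1).+1 <= a%:R ^- 3 :> R.
  rewrite lef_pV2 ?posrE ?exprn_gt0 // -!natrX ler_nat leq_pexp2l //; lia.
have H2 := zsum_diff_le (aN : (a <= N)%N).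
have D0 : 0 <= zs (N + a) 1 - zs (N - a) 1 by rewrite subr_ge0; apply: zsum_le; lia.
apply: (le_trans (ler_pM _ D0 H1 H2)); first by rewrite invr_ge0 exprn_ge0.
have b0 : 0 < (N - a).+1%:R :> R by [].
have -> : a%:R ^- 3 * (2 * a%:R * (N - a).+1%:R^-1) =
    2 * ((a%:R * (N - a).+1%:R)^-1 * a%:R ^- 1) :> R.
  rewrite expr1; move: b0; move: ((N - a).+1%:R) => b b0.
  by field; rewrite !gt_eqF.
rewrite ler_wpM2l // ler_wpM2r ?invr_ge0 ?exprn_ge0 //.
rewrite lef_pV2 ?posrE ?mulr_gt0 // -natrM ler_nat.
have -> : N = (N - a + a)%N by lia.
move: (N - a)%N a1 => c a1; rewrite addnK; nia.
Qed.

(** The bound is twice the Cesàro mean of the harmonic sequence, which tends to 0. *)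
Lemma cvg_zsum_err n : (2 <= n)%N -> (fun N => zsum_err N.+1 n) @ \oo --> (0 : R).
Proof.
move=> n2; apply: (@squeeze_cvgr _ _ _ _ (cst 0) (fun N => 2 * arithmetic_mean (@harmonic R) N)).
- near=> N; rewrite zsum_err_ge0 /=; apply: le_trans (zsum_err_le _ n2) _ => //.
  rewrite /zsum big_add1 /= /series /=.
  by under eq_bigr do rewrite expr1.
- exact: cvg_cst.
- rewrite -[X in _ --> X](mulr0 2); apply: cvgMr; apply: cesaro; exact: cvg_harmonic.
Unshelve. all: by end_near. Qed.

Lemma cvg_sum_seq I (s : seq I) (f : I -> nat -> R) (l : I -> R) (P : pred I) :
  (forall i, P i -> f i @ \oo --> l i) ->
  (fun N => \sum_(i <- s | P i) f i N) @ \oo --> \sum_(i <- s | P i) l i.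
Proof.
move=> H; elim: s => [|i s IH].
  by rewrite big_nil; under eq_fun do rewrite big_nil; exact: cvg_cst.
rewrite big_cons; under eq_fun do rewrite big_cons.
by case: ifP => // Pi; apply: cvgD => //; apply: H.
Qed.

Lemma zeta_conv n : (2 <= n)%N ->
  \sum_(1 <= j < n) zeta (2 * j) * zeta (2 * (n - j)) =
  (n%:R + 2^-1) * zeta (2 * n) :> R.
Proof.
move=> n2; have cz k : (2 <= k)%N -> (fun N => zs N.+1 k) @ \oo --> (zeta k : R).
  by move=> k2; rewrite (cvg_shiftS (fun N => zs N k)); exact: cvg_zsum.
have L : (fun N => \sum_(1 <= j < n) zs N.+1 (2 * j) * zs N.+1 (2 * (n - j))) @ \oo -->
    (\sum_(1 <= j < n) zeta (2 * j) * zeta (2 * (n - j)) : R).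
  rewrite big_nat; under eq_fun do rewrite big_nat.
  by apply: cvg_sum_seq => j /andP[j1 jn]; apply: cvgM; apply: cz; lia.
have L' : (fun N => \sum_(1 <= j < n) zs N.+1 (2 * j) * zs N.+1 (2 * (n - j))) @ \oo -->
    (n%:R + 2^-1) * (zeta (2 * n) : R) - 0.
  under eq_fun do rewrite zsum_conv //.
  apply: cvgB; last exact: cvg_zsum_err.
  by apply: cvgMr; apply: cz; lia.
by rewrite -[RHS]subr0; apply: cvg_unique L L'.
Qed.
End ZetaLimits.

Lemma sum_even_index (V : zmodType) (f : nat -> V) m :
  (forall i, odd i -> f i = 0) ->
  \sum_(i < (2 * m).+1) f i = \sum_(j < m.+1) f (2 * j)%N.
Proof.
move=> f0; elim: m => [|m IH]; first by rewrite !big_ord1.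
have -> : (2 * m.+1)%N = (2 * m).+2 by lia.
rewrite 2!big_ord_recr /= IH [RHS]big_ord_recr /= (f0 (2 * m).+1) ?addr0; last first.
  by rewrite /= oddM.
by congr (_ + f _); lia.
Qed.

(** * The matching quadratic recurrence for Bernoulli numbers *)

Section BernoulliConvolution.
(* (z/2) coth (z/2) *)
Let g : fps rat := fun n => if n == 1%N then 0 else bern_fps n.

(** Dropping B_1 = -1/2 adds z/2, which completes the square in [bern_fps_riccati] and makes the
    equation invariant under z -> -z. *)
Let g_ode : fps_theta g = g - g ^+ 2 + fpsC (4^-1) * fpsX rat ^+ 2.
Proof.
have gE : g = bern_fps + fpsC (2^-1) * fpsX rat.
  apply/funext => n; rewrite fpsD fpsCM /g /fpsX.
  case: eqP => [->|_]; last by rewrite mulr0 addr0.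
  by rewrite /bern_fps bernoulli1 divr1 mulr1 addNr.
have half : fpsC (2^-1) *+ 2 = 1 :> fps rat.
  by rewrite -rmorphMn (_ : 2^-1 *+ 2 = 1 :> rat) // rmorph1.
have quarter : fpsC (4^-1) = fpsC (2^-1) ^+ 2 :> fps rat.
  by rewrite -rmorphXn.
rewrite gE raddfD /= bern_fps_riccati fps_thetaM fps_thetaC fps_thetaX quarter.
rewrite mul0r add0r.
transitivity (bern_fps - fpsX rat * bern_fps * (fpsC (2^-1) *+ 2) - bern_fps ^+ 2 +
  fpsC 2^-1 * fpsX rat); [by rewrite half mulr1|by ring].
Qed.

Let g_rec n : (2 < n)%N -> n%:R * g n = g n - \sum_(i < n.+1) g i * g (n - i)%N.
Proof.
move=> n2; have := congr1 (fun f => f n) g_ode.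
rewrite !(fpsD, fpsN) fpsCM fpsXn expr2 fpsM /fps_theta mulr_natl => ->.
by rewrite gtn_eqF // mulr0 addr0.
Qed.

(** In a convolution of odd total index, each inner product contains a smaller odd index and
    vanishes by induction; the two end terms leave (n + 1) g_n = 0. *)
Lemma bern_fps_odd n : odd n -> (1 < n)%N -> bern_fps n = 0.
Proof.
suff H : odd n -> g n = 0.
  by move=> on n1; rewrite -(H on) /g gtn_eqF.
elim/ltn_ind: n => n IH on; have [n1|n1] := leqP n 1.
  by have -> : n = 1%N by case: n on n1 {IH} => [|[]].
case: n => // n in IH on n1 *.
have n2 : (2 < n.+1)%N by case: n on n1 {IH} => [|[|]].
have := g_rec n2; rewrite big_ord_recl big_ord_recr /= subnn subn0 big1 => [|i _].
  have -> : g 0%N = 1 by [].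
  move=> E; apply/eqP; have : n.+2%:R * g n.+1 = 0 by rewrite -natr1 mulrDl E; ring.
  by move/eqP; rewrite mulf_eq0 pnatr_eq0.
rewrite /bump add1n; have i1 := ltn_ord i.
case: (boolP (odd i.+1)) => oi; first by rewrite (IH i.+1) ?mul0r //; lia.
by rewrite (IH (n.+1 - i.+1)%N) ?mulr0 //; lia.
Qed.

Lemma bern_fps_conv n : (2 <= n)%N ->
  \sum_(1 <= j < n) bern_fps (2 * j)%N * bern_fps (2 * (n - j))%N =
  - (2 * n).+1%:R * bern_fps (2 * n)%N.
Proof.
move=> n2; have gb j : g (2 * j)%N = bern_fps (2 * j)%N by rewrite /g; case: eqP => //; lia.
have g1 i : odd i -> g i = 0.
  move=> oi; rewrite /g; case: eqP => // i1; apply: bern_fps_odd => //.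
  by case: i oi i1 => [|[]].
have := @g_rec (2 * n)%N; have -> : (2 < 2 * n)%N by lia.
move=> /(_ isT); rewrite (@sum_even_index _ (fun i => g i * g (2 * n - i)%N)); last first.
  by move=> i oi; rewrite g1 ?mul0r.
rewrite -(big_mkord xpredT (fun i => g (2 * i)%N * g (2 * n - 2 * i)%N)).
rewrite big_ltn // big_nat_recr; last by lia.
have -> : \sum_(1 <= i < n) g (2 * i)%N * g (2 * n - 2 * i)%N =
    \sum_(1 <= j < n) bern_fps (2 * j)%N * bern_fps (2 * (n - j))%N.
  by apply: eq_bigr => j _; rewrite -mulnBr !gb.
rewrite /= muln0 subn0 subnn gb -natr1.
have -> : g 0%N = 1 by [].
set S := \sum_(1 <= j < n) _ => E.
transitivity (- bern_fps (2 * n)%N -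
  (bern_fps (2 * n)%N - (1 * bern_fps (2 * n)%N + (S + bern_fps (2 * n)%N * 1)))).
  by ring.
by rewrite -E; ring.
Qed.
End BernoulliConvolution.

(** Both sides satisfy the same quadratic recurrence, by [zeta_conv] and [bern_fps_conv]. The case n
    = 1, where [bern_fps 2] is 1/12, dictates T = 24 zeta(2). *)
Lemma zeta_even (R : realType) n : (0 < n)%N ->
  zeta (2 * n) = - 2^-1 * (- (24 * zeta 2)) ^+ n * ratr (bern_fps (2 * n)%N) :> R.
Proof.
set T := 24 * zeta 2; elim/ltn_ind: n => n IH n0.
have [n1|n2] := leqP n 1.
  have -> : n = 1%N by lia.
  rewrite /bern_fps bernoulli2 (_ : 6^-1 / (2 * 1)`!%:R = 12%:R^-1 :> rat) //.
  by rewrite fmorphV /= rmorph_nat expr1 muln1 /T; field.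
have := zeta_conv R n2; rewrite (eq_big_nat _ _ (F2 := fun j =>
    4^-1 * (- T) ^+ n * ratr (bern_fps (2 * j)%N * bern_fps (2 * (n - j))%N))); last first.
  move=> j /andP[j1 jn]; rewrite (IH j) // (IH (n - j)%N) ?subn_gt0 //; last by lia.
  have -> : (- T) ^+ n = (- T) ^+ j * (- T) ^+ (n - j) by rewrite -exprD subnKC // ltnW.
  move: (bern_fps (2 * j)%N) (bern_fps (2 * (n - j))%N) => x y.
  by move: (_ ^+ j) (_ ^+ (n - j)) => p q; rewrite rmorphM /=; field.
rewrite -mulr_sumr -rmorph_sum bern_fps_conv // => E.
have n0' : n%:R + 2^-1 != 0 :> R by rewrite gt_eqF // ltr_wpDl.
apply: (mulfI n0'); rewrite -E; move: (bern_fps _) => b.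
have En : (2 * n).+1%:R = 2 * n%:R + 1 :> R by rewrite -natr1 natrM.
by move: (_ ^+ n) => p; rewrite rmorphM rmorphN /= rmorph_nat En; field.
Qed.

(** * From real to rational q-expansions *)

Section Main.
Variable R : realType.
Let c : R := - (24 * zeta 2).

(** Nonvanishing of B_2n is read off from zeta(2n) >= 1; it is required because [E_qexp] divides by
    B_2n. *)
Lemma bern_fps_even_neq0 n : (0 < n)%N -> bern_fps (2 * n)%N != 0.
Proof.
move=> n0; apply/eqP => b0; have := @zeta_ge1 R (2 * n)%N.
have -> : (2 <= 2 * n)%N by lia.
by rewrite zeta_even // b0 rmorph0 mulr0 ler10 => /(_ isT).
Qed.

Lemma G_qexpE n : (0 < n)%N ->
  G_qexp (2 * n) = (fun m => c ^+ n * ratr (G_rat (2 * n) m)) :> qexp R.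
Proof.
move=> n0; apply/funext => m.
rewrite /G_qexp zeta_even // -/c /E_qexp /G_rat; case: eqP => _.
  rewrite (_ : - bernoulli _ / _ = - bern_fps (2 * n)%N); last by rewrite mulNr.
  by move: (bern_fps _) (_ ^+ n) => b p; rewrite rmorphN /=; field.
have := bern_fps_even_neq0 n0; rewrite /bern_fps mulf_eq0 negb_or => /andP[B0 _].
set B := bernoulli _ in B0 *.
have -> : 2 / (2 * n).-1`!%:R * (sigma (2 * n).-1 m)%:R =
   B / (2 * n)`!%:R * ((2 * (2 * n))%:R / B) * (sigma (2 * n).-1 m)%:R :> rat.
  congr (_ * _); have -> : (2 * n)`! = (2 * n * (2 * n).-1`!)%N.
    by rewrite -{1}(prednK (_ : 0 < 2 * n)%N) ?muln_gt0 // factS prednK // muln_gt0.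
  rewrite !natrM; field.
  rewrite B0 natr_fact_neq0 pnatr_eq0; lia.
rewrite (_ : B / _ = bern_fps (2 * n)%N) //.
move: (bern_fps _) (_ / B) (_ ^+ n) => b e p.
by rewrite !rmorphM /= rmorph_nat; field.
Qed.

Lemma qmul_ratr (s t : R) (f g : qexp rat) :
  qmul (fun m => s * ratr (f m)) (fun m => t * ratr (g m)) =
  (fun m => s * t * ratr (qmul f g m)).
Proof.
apply/funext => m; rewrite /qmul rmorph_sum mulr_sumr; apply: eq_bigr => i _.
by rewrite rmorphM /=; ring.
Qed.

Lemma qpow_ratr (s : R) (f : qexp rat) n :
  qpow (fun m => s * ratr (f m)) n = (fun m => s ^+ n * ratr (qpow f n m)).
Proof.
elim: n => [|n IH]; last by rewrite /= IH qmul_ratr exprS.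
by apply/funext => -[|m]; rewrite mul1r /= ?rmorph1 ?rmorph0.
Qed.
End Main.

(* For even k >= 4, if G_k = sum_{a,b >= 0, 4a+6b=k} w_a G_4^a G_6^b
   (as q-expansions, i.e. as modular forms), then nu_2(w_a) >= 0 for all a. *)
Theorem theorem4p1 (R : realType) (k : nat) (w : nat -> rat) :
  (4 <= k)%N -> ~~ odd k ->
  (forall n : nat,
     G_qexp (R := R) k n =
     \sum_(0 <= a < (k %/ 4).+1 | (6 %| k - 4 * a)%N)
        ratr (w a) * qmul (qpow (G_qexp 4) a) (qpow (G_qexp 6) ((k - 4 * a) %/ 6)) n) ->
  forall a : nat, (4 * a <= k)%N -> (6 %| k - 4 * a)%N -> nu_ge0 2 (w a).
Proof.
move=> k4 ek H a ak a6; apply: int2_nu_ge0.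
apply: (G_rat_int2 k4 ek) a6 => //n.
pose c : R := - (24 * zeta 2).
have c0 : c != 0.
  rewrite oppr_eq0 mulf_neq0 ?pnatr_eq0 // gt_eqF //.
  exact: lt_le_trans ltr01 (zeta_ge1 R (leqnn 2)).
have kE : k = (2 * (k %/ 2))%N by lia.
apply: (fmorph_inj (@ratr R)); apply: (mulfI (expf_neq0 (k %/ 2) c0)).
have := H n; rewrite {1}kE G_qexpE; last by lia.
rewrite -kE -/c => ->; rewrite rmorph_sum mulr_sumr.
have G4 : G_qexp 4 = (fun m => c ^+ 2 * ratr (G_rat 4 m)) := G_qexpE R (isT : 0 < 2)%N.
have G6 : G_qexp 6 = (fun m => c ^+ 3 * ratr (G_rat 6 m)) := G_qexpE R (isT : 0 < 3)%N.
rewrite big_nat_cond [RHS]big_nat_cond; apply: eq_bigr => i /andP[/andP[_ ik] i6].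
rewrite G4 G6 !qpow_ratr qmul_ratr -!exprM -exprD.
(* Homogeneity: every monomial of weight k carries the same power c^(k/2), which then cancels. *)
have -> : (2 * i + 3 * ((k - 4 * i) %/ 6) = k %/ 2)%N by lia.
by rewrite rmorphM /= mulrCA.
Qed.
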